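(* There exist absolute constants $c, C, C'>0$ such that for all $n\ge 2$, all $p\in(0,1]$, and every real $$k\in \left(2,\ \frac{c\left(\frac{\log(np)}{\log n}\right)^2p(n - 1)-\log(8(n-1))}{\log(\frac{1}{p})+\log(11^5/4)}\right],$$ one has $$\left[\mathbb{E}\left( \|A_p\|- \mathbb{E} \|A_p\| \right)^k_+ \right]^{1/k} \le (Ckp)^{1/2}$$ and $$\left[\mathbb{E} \left( \|A_p\|- \mathbb{E} \|A_p\| \right)^k_- \right]^{1/k} \le (C'kp)^{1/2}.$$ In particular, for some absolute constant $\kappa > 0$, it holds for all $n$ and all $p\in[0,1]$ with $p \ge \kappa\log^3(n)/n$ that $$\mathrm{Var}(\|A_p\|) \le Cp.$$
   Context: For a positive integer $n$, let $(U_{i,j})_{1\le i<j\le n}$ be independent random variables uniformly distributed on $[0,1]$. For $p\in[0,1]$, the adjacency matrix $A_p$ of the Erdős–Rényi random graph $G(n,p)$ is the symmetric $n\times n$ matrix with zero diagonal and with entries $A^{(p)}_{i,j}=A^{(p)}_{j,i}=\mathbf{1}_{U_{i,j}<p}$ for $1\le i<j\le n$. $\|A_p\|$ denotes the spectral norm of $A_p$ (equal to its largest eigenvalue). For a real number $x$, $x_+=\max(x,0)$, $x_-=\max(-x,0)$, and $(x)_{\pm}^k=(x_{\pm})^k$. $\log$ is the natural logarithm and $\log^3(n)=(\log n)^3$. If the interval for $k$ is empty, the moment assertions are vacuous. *)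

(* Defs.v *)
From mathcomp Require Export all_boot all_order all_algebra.
From mathcomp Require Export all_classical all_reals all_analysis.
Export Order.TTheory GRing.Theory Num.Theory.
Export numFieldNormedType.Exports.

Set Implicit Arguments.
Unset Strict Implicit.
Unset Printing Implicit Defensive.

Local Open Scope classical_set_scope.
Local Open Scope ring_scope.

Definition l2norm (R : realType) (n : nat) (x : 'cV[R]_n) : R :=
  Num.sqrt (\sum_(i < n) x i 0 ^+ 2).

(* The operator norm of A from l2 to l2; the set is nonempty and bounded. *)
Definition spectral_norm (R : realType) (n : nat) (A : 'M[R]_n) : R :=
  sup [set l2norm (A *m x) | x in [set x : 'cV[R]_n | l2norm x <= 1]].

Definition mutually_independent (d : measure_display) (T : measurableType d)
    (R : realType) (P : probability T R) (I : finType)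
    (X : I -> {RV P >-> R}) : Prop :=
  forall (J : {set I}) (B : I -> set R),
    (forall i, i \in J -> measurable (B i)) ->
    (P (\bigcap_(i in [set i | i \in J]) (X i @^-1` B i)) =
     \prod_(i in J) P (X i @^-1` B i))%E.

Definition uniform01 (d : measure_display) (T : measurableType d)
    (R : realType) (P : probability T R) (X : {RV P >-> R}) : Prop :=
  forall B : set R, measurable B ->
    distribution P X B = uniform_prob (@ltr01 R) B.

(* Only the variables U i j with i < j are constrained; the others are never
   used below. *)
Definition iid_uniform (d : measure_display) (T : measurableType d)
    (R : realType) (P : probability T R) (n : nat)
    (U : 'I_n -> 'I_n -> {RV P >-> R}) : Prop :=
  mutually_independent
    (fun e : {e : 'I_n * 'I_n | (e.1 < e.2)%N} => U (val e).1 (val e).2) /\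
  (forall i j : 'I_n, (i < j)%N -> uniform01 (U i j)).

Definition adjacency (d : measure_display) (T : measurableType d)
    (R : realType) (P : probability T R) (n : nat)
    (U : 'I_n -> 'I_n -> {RV P >-> R}) (p : R) (w : T) : 'M[R]_n :=
  \matrix_(i < n, j < n)
    if (i < j)%N then (U i j w < p)%R%:R
    else if (j < i)%N then (U j i w < p)%R%:R
    else 0.

Definition adjacency_norm (d : measure_display) (T : measurableType d)
    (R : realType) (P : probability T R) (n : nat)
    (U : 'I_n -> 'I_n -> {RV P >-> R}) (p : R) (w : T) : R :=
  spectral_norm (adjacency U p w).

(* The expectation is taken in the extended reals; X is centered at the real
   number underlying 'E_P[X], which is meant to be finite. *)
Definition upper_moment (d : measure_display) (T : measurableType d)
    (R : realType) (P : probability T R) (X : T -> R) (k : R) : \bar R :=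
  ('E_P[fun w => (Num.max (X w - fine 'E_P[X]) 0 `^ k)%R])%E.

Definition lower_moment (d : measure_display) (T : measurableType d)
    (R : realType) (P : probability T R) (X : T -> R) (k : R) : \bar R :=
  ('E_P[fun w => (Num.max (- (X w - fine 'E_P[X])) 0 `^ k)%R])%E.

Definition moment_range (R : realType) (c : R) (n : nat) (p : R) : set R :=
  [set k : R | 2 < k <=
    (c * (ln (n%:R * p) / ln n%:R) ^+ 2 * p * (n%:R - 1) - ln (8 * (n%:R - 1)))
    / (ln (p^-1) + ln (11 ^+ 5 / 4))].

(* Main.v *)
Require Import Defs.
From mathcomp Require Import ring lra.

(** The norm [Z] depends on the graph only, so everything happens on the cube of
    edge indicators.  If [v] is the Perron vector of the graph [x], then
    [Z x - Z y <= sum_e al_e [x_e <> y_e]] with [al_e = 2 v_i v_j x_e], and the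
    functional form of Talagrand's convex distance inequality gives
    [E exp (Z - 4 |al|^2) * E exp (- Z) <= 1].  Applied to multiples of [Z],
    this controls both tails around the mean by [|al|^2], which is at most 2.

    With high probability [|al|^2 <= C p].  Write [D = (n - 1) p], and let [M]
    be the largest entry of [v].  Degrees are at most [(1 + de) D] and the
    largest eigenvalue is at least [(1 - de) D], so a vertex where [v] is
    nearly [M] has many neighbours where [v] is nearly [M].  Since small sets
    expand, the level sets of [v] grow geometrically, and after about
    [8 ln n / ln (n p)] steps a constant fraction of the vertices satisfies
    [v >= M / 4].  Hence [M ^ 2 <= 512 / n] and
    [|al|^2 <= 2 M ^ 2 Z <= C p]. *)

Set Implicit Arguments.
Unset Strict Implicit.
Unset Printing Implicit Defensive.

Local Open Scope classical_set_scope.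
Local Open Scope ring_scope.

(** * Bernoulli averages on the discrete cube *)

(** The bound [|al|^2 <= 2] alone gives tails that do not see [p]; the factor [p] comes only from
    delocalization, which fails on a rare event. There the k-th moment is bounded using
    [|al|^2 <= 2], and this stays within [(C k p)^(k/2)] as soon as the event has probability at
    most [p^k].

    This requirement produces the range of [k]. The level-set argument descends through [l], about
    [8 ln n / ln (n p)], levels, so it tolerates only relative errors of order [1/l] in the degrees
    and in the top eigenvalue. Chernoff bounds make larger errors as rare as [n exp (- c D / l^2)],
    and asking for at most [p^k] bounds [k] by a multiple of [(ln (n p) / ln n)^2 D], less a
    logarithm, over [ln (1/p)].

    Bounded differences would need weights uniform in the graph, whereas Perron weights change with
    it; this is why a convex-distance inequality is used. *)

Definition upd (I : finType) (x : {ffun I -> bool}) (i : I) (b : bool) : {ffun I -> bool} :=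
  [ffun j => if j == i then b else x j].

(** Only the coordinates listed in [s] are resampled, the others being read off [x]; this makes
    induction on coordinates structural. Over an enumeration of [I] it is the expectation under the
    product Bernoulli(p) law. *)
Fixpoint Es (R : realType) (p : R) (I : finType) (s : seq I)
    (f : {ffun I -> bool} -> R) (x : {ffun I -> bool}) : R :=
  if s is i :: s' then
    p * Es p s' f (upd x i true) + (1 - p) * Es p s' f (upd x i false)
  else f x.

Section BernoulliMean.
Variables (R : realType) (p : R) (I : finType).
Implicit Types (s : seq I) (f g : {ffun I -> bool} -> R) (x : {ffun I -> bool}).

Lemma eq_Es s f g : f =1 g -> Es p s f =1 Es p s g.
Proof. by move=> fg; elim: s => //= i s IH x; rewrite !IH. Qed.

Lemma EsD s f g x : Es p s (fun y => f y + g y) x = Es p s f x + Es p s g x.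
Proof. by elim: s x => //= i s IH x; rewrite !IH; ring. Qed.

Lemma EsZ s c f x : Es p s (fun y => c * f y) x = c * Es p s f x.
Proof. by elim: s x => //= i s IH x; rewrite !IH; ring. Qed.

Lemma EsC s c x : Es p s (fun=> c) x = c.
Proof. by elim: s x => //= i s IH x; rewrite !IH; ring. Qed.

Lemma Es_sum (J : finType) (P : pred J) s (F : J -> {ffun I -> bool} -> R) x :
  Es p s (fun y => \sum_(j | P j) F j y) x = \sum_(j | P j) Es p s (F j) x.
Proof.
elim: s x => //= i s IH x; rewrite !IH !mulr_sumr -big_split.
by apply: eq_bigr => j _.
Qed.

Hypothesis p01 : 0 <= p <= 1.

Lemma ler_Es s f g x : (forall y, f y <= g y) -> Es p s f x <= Es p s g x.
Proof.
move=> fg; elim: s x => //= i s IH x; case/andP: p01 => p0 p1.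
by apply: lerD; apply: ler_wpM2l; rewrite ?subr_ge0.
Qed.

Lemma Es_ge0 s f x : (forall y, 0 <= f y) -> 0 <= Es p s f x.
Proof. by move=> f0; rewrite -[leLHS](EsC s 0 x); exact: ler_Es. Qed.

Lemma Es_gt0 s f x : (forall y, 0 < f y) -> 0 < Es p s f x.
Proof.
move=> f0; elim: s x => //= i s IH x; case/andP: p01 => p0 p1.
have := IH (upd x i true); have := IH (upd x i false).
set a := Es _ _ _ _; set b := Es _ _ _ _ => a0 b0.
case: (leP p (1/2)) => ph; first by apply: ltr_wpDl; [exact: mulr_ge0 (ltW b0) | apply: mulr_gt0 => //; lra].
by apply: ltr_pwDl; [apply: mulr_gt0 => //; lra | apply: mulr_ge0 (ltW a0); lra].
Qed.

Lemma Es_pull s (i : I) (h : bool -> R) f x : i \notin s ->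
  Es p s (fun y => h (y i) * f y) x = h (x i) * Es p s f x.
Proof.
elim: s x => //= j s IH x; rewrite inE negb_or => /andP[ij nis].
by rewrite !IH // !ffunE (negbTE ij); ring.
Qed.

Lemma Es_prod s (h : I -> bool -> R) x : uniq s ->
  Es p s (fun y => \prod_(i <- s) h i (y i)) x =
  \prod_(i <- s) (p * h i true + (1 - p) * h i false).
Proof.
elim: s x => [|i s IH] x /=; first by rewrite !big_nil.
case/andP=> nis us.
rewrite !(@eq_Es s _ (fun y => h i (y i) * \prod_(j <- s) h j (y j))); last first.
- by move=> y; rewrite big_cons.
- by move=> y; rewrite big_cons.
by rewrite !Es_pull // !IH // big_cons !ffunE eqxx; ring.
Qed.

(** From [exp (-y) >= 1 - y] one gets [exp y * (1 - y) <= 1], while [(1 + y + 2 y^2) (1 - y) = 1 +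
    y^2 (1 - 2 y)]. There is no lower restriction on [y], so it serves both tails; it also supplies
    the crude numerical values of [exp] below. *)
Lemma expR_le_quad (y : R) : y <= 1/2 -> expR y <= 1 + y + 2 * y ^+ 2.
Proof.
move=> y2; have := expR_ge1Dx (- y); rewrite expRN => h.
have e0 := expR_gt0 y.
have : expR y * (1 - y) <= 1.
  by rewrite -ler_pdivlMl // mulr1.
move=> h1; have y1 : 0 < 1 - y by lra.
rewrite -(ler_pM2r y1); apply: (le_trans h1).
have -> : (1 + y + 2 * y ^+ 2) * (1 - y) = 1 + y ^+ 2 * (1 - 2 * y) by ring.
by rewrite lerDl; apply: mulr_ge0; [exact: sqr_ge0 | lra].
Qed.

Lemma Es_expR_sum s (y : I -> R) x : uniq s -> (forall i, y i <= 1/2) ->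
  Es p s (fun z => expR (\sum_(i <- s) y i * (z i)%:R)) x
  <= expR (p * \sum_(i <- s) (y i + 2 * y i ^+ 2)).
Proof.
move=> us y2.
pose h (i : I) (b : bool) := expR (y i * b%:R).
rewrite (@eq_Es s _ (fun z => \prod_(i <- s) h i (z i))); last first.
  by move=> z; rewrite expR_sum.
rewrite Es_prod // mulr_sumr expR_sum; apply: ler_prod => i _.
rewrite /h mulr1 mulr0 expR0.
case/andP: p01 => p0 p1; apply/andP; split.
  by apply: addr_ge0; apply: mulr_ge0; rewrite ?subr_ge0 ?expR_ge0.
have q := expR_le_quad (y2 i).
apply: le_trans (expR_ge1Dx _).
have := ler_wpM2l p0 q; lra.
Qed.

End BernoulliMean.

(** * Transport inequality *)

(* Closed form of the minimum over [th] in [0, 1] of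
   [(1 - th) * a + th * b + th ^+ 2 / 16]. *)
Definition infconv2 (R : realType) (a b : R) : R :=
  if a <= b then a else
  if a - b <= 1/8 then a - 4 * (a - b) ^+ 2 else b + 1/16.

Lemma infconv2_le (R : realType) (a b th : R) : 0 <= th <= 1 ->
  infconv2 a b <= (1 - th) * a + th * b + th ^+ 2 / 16.
Proof.
case/andP=> t0 t1; rewrite /infconv2; have s0 := sqr_ge0 th.
case: ifPn => [ab|]; first by nra.
rewrite -ltNge => ba; case: ifPn => [_|].
  have := sqr_ge0 (th - 8 * (a - b)); nra.
rewrite -ltNge => ab; have := sqr_ge0 (1 - th); nra.
Qed.

Lemma infconv2_attained (R : realType) (a b : R) : exists2 th : R, 0 <= th <= 1 &
  infconv2 a b = (1 - th) * a + th * b + th ^+ 2 / 16.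
Proof.
rewrite /infconv2; case: ifPn => [ab|]; first by exists 0; [lra | field].
rewrite -ltNge => ba; case: ifPn => [ab|].
  by exists (8 * (a - b)); [lra | field].
by exists 1; [lra | field].
Qed.

(** Source of the factor 4 in [4 |al|^2]: the minimum of [- th d + th^2 / 16] over all real [th] is
    [- 4 d^2]. *)
Lemma infconv2_ge (R : realType) (a b c d : R) : c <= a -> c - d <= b ->
  c - 4 * d ^+ 2 <= infconv2 a b.
Proof.
move=> ca cb; have [th /andP[t0 t1] ->] := infconv2_attained a b.
have := sqr_ge0 (th - 8 * d).
have : (1 - th) * c <= (1 - th) * a by apply: ler_wpM2l => //; lra.
have : th * (c - d) <= th * b by exact: ler_wpM2l.
nra.
Qed.

(** With [u = b - a], everything reduces to [exp s + exp (-u) <= 2]. For small [u] one has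
    [s = u - 4 u^2], and its [4 u^2] absorbs exactly the errors [2 s^2] and [2 u^2] of
    [expR_le_quad]; this fixes the cost [th^2 / 16]. For larger [u], [s] is capped at 1/16. *)
Lemma two_point_transport_le (R : realType) (p q a b : R) : 0 <= p -> 0 <= q -> p + q = 1 ->
  a <= b ->
  (p * expR (infconv2 a b) + q * expR (infconv2 b a)) * (p * expR (- a) + q * expR (- b)) <= 1.
Proof.
move=> p0 q0 pq ab; set u := b - a; have u0 : 0 <= u by rewrite subr_ge0.
have [s -> H] : exists2 s, infconv2 b a = a + s & expR s + expR (- u) <= 2.
  rewrite /infconv2; case: ifPn => [ba|_].
    exists (b - a); first by ring.
    have -> : u = 0 by apply/eqP; rewrite eq_le u0 subr_le0 ba.
    have -> : b - a = 0 by apply/eqP; rewrite subr_eq0 eq_le ab ba.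
    by rewrite oppr0 expR0; lra.
  case: ifPn => [u8|].
    exists (u - 4 * u ^+ 2); first by rewrite /u; ring.
    have s1 : u - 4 * u ^+ 2 <= 1 / 2 by have := sqr_ge0 u; rewrite -/u in u8; lra.
    have h1 := expR_le_quad s1.
    have n1 : - u <= 1 / 2 by lra.
    have h2 := expR_le_quad n1.
    have : (u - 4 * u ^+ 2) ^+ 2 <= u ^+ 2.
      rewrite -/u in u8; apply: lerXn2r; rewrite ?nnegrE //; nra.
    nra.
  rewrite -/u -ltNge => u8; exists (1 / 16) => //.
  have s1 : (1 / 16 : R) <= 1 / 2 by lra.
  have h1 := expR_le_quad s1.
  have n1 : (- (1 / 8) : R) <= 1 / 2 by lra.
  have h2 := expR_le_quad n1.
  have : expR (- u) <= expR (- (1 / 8)) by rewrite ler_expR; lra.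
  lra.
have -> : infconv2 a b = a by rewrite /infconv2 ab.
have -> : - b = - a + - u by rewrite /u; ring.
rewrite !expRD.
have -> : (p * expR a + q * (expR a * expR s)) *
    (p * expR (- a) + q * (expR (- a) * expR (- u))) =
    (expR a * expR (- a)) * ((p + q * expR s) * (p + q * expR (- u))) by ring.
rewrite -expRD subrr expR0 mul1r.
have -> : p = 1 - q by lra.
have E0 := expR_gt0 s; have F0 := expR_gt0 (- u).
have q1 : q <= 1 by lra.
set E := expR s in H E0 *; set F := expR (- u) in H F0 *.
have F1 : 0 <= 1 - q + q * F by apply: addr_ge0; [lra | apply: mulr_ge0 => //; lra].
(* Replacing [E] by [2 - F] turns the product into [(1 + q (1 - F)) (1 - q (1 - F))], a difference
   of squares. *)
have : (1 - q + q * E) * (1 - q + q * F) <= (1 - q + q * (2 - F)) * (1 - q + q * F).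
  by apply: ler_wpM2r => //; rewrite lerD2l; apply: ler_wpM2l => //; lra.
move/le_trans; apply; have := sqr_ge0 (q * (1 - F)); nra.
Qed.

Definition flip (I : finType) (x : {ffun I -> bool}) (i : I) : {ffun I -> bool} :=
  upd x i (~~ x i).

Lemma flip_upd (I : finType) (x : {ffun I -> bool}) (i : I) b :
  flip (upd x i b) i = upd x i (~~ b).
Proof. by apply/ffunP=> j; rewrite !ffunE eqxx; case: (j == i). Qed.

Lemma flip_updC (I : finType) (x : {ffun I -> bool}) (i j : I) b : i != j ->
  flip (upd x j b) i = upd (flip x i) j b.
Proof.
move=> ij; apply/ffunP=> k; rewrite !ffunE (negbTE ij).
by case: (eqVneq k i) => // ->; rewrite (negbTE ij).
Qed.

Fixpoint infconv (R : realType) (I : finType) (s : seq I)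
    (f : {ffun I -> bool} -> R) (x : {ffun I -> bool}) : R :=
  if s is i :: s' then infconv2 (infconv s' f x) (infconv s' f (flip x i)) else f x.

Section Transport.
Variables (R : realType) (p : R) (I : finType).
Implicit Types (s : seq I) (f g : {ffun I -> bool} -> R) (x : {ffun I -> bool}).
Hypothesis p01 : 0 <= p <= 1.

Lemma Es_flip s i g x : i \notin s ->
  Es p s (fun y => g (flip y i)) x = Es p s g (flip x i).
Proof.
elim: s x => //= j s IH x; rewrite inE negb_or => /andP[ij nis].
by rewrite !IH // !flip_updC.
Qed.

Lemma expR_convex_comb (th a b : R) : 0 <= th <= 1 ->
  expR ((1 - th) * a + th * b) <= (1 - th) * expR a + th * expR b.
Proof.
move=> /andP[t0 t1]; set m := _ + _.
have ha : expR m * (1 + (a - m)) <= expR a.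
  have -> : expR a = expR m * expR (a - m) by rewrite -expRD addrC subrK.
  by apply: ler_wpM2l; [exact: expR_ge0 | exact: expR_ge1Dx].
have hb : expR m * (1 + (b - m)) <= expR b.
  have -> : expR b = expR m * expR (b - m) by rewrite -expRD addrC subrK.
  by apply: ler_wpM2l; [exact: expR_ge0 | exact: expR_ge1Dx].
have t1' : 0 <= 1 - th by lra.
have := lerD (ler_wpM2l t1' ha) (ler_wpM2l t0 hb).
apply: le_trans; rewrite le_eqVlt; apply/orP; left; apply/eqP; rewrite /m; ring.
Qed.

(* Functional form of Talagrand's convex distance inequality. *)
Lemma Es_infconv s f x : uniq s ->
  Es p s (fun y => expR (infconv s f y)) x * Es p s (fun y => expR (- f y)) x <= 1.
Proof.
elim: s x => [|i s IH] x /=; first by rewrite -expRD subrr expR0.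
case/andP=> nis us.
(* [u] is a soft minimum of [f] over the coordinates of [s]. It plays the role of [f] in the
   two-point inequality for the remaining coordinate [i]. *)
pose u z := - ln (Es p s (fun y => expR (- f y)) z).
have Eu z : Es p s (fun y => expR (- f y)) z = expR (- u z).
  by rewrite /u opprK lnK // posrE; apply: Es_gt0 => // y; exact: expR_gt0.
have IHu z : Es p s (fun y => expR (infconv s f y - u z)) z <= 1.
  have := IH z us; rewrite Eu mulrC -EsZ.
  by rewrite (@eq_Es _ _ _ _ _ (fun y => expR (infconv s f y - u z))) // => y; rewrite -expRD addrC.
have key z : Es p s (fun y => expR (infconv2 (infconv s f y) (infconv s f (flip y i)))) z
    <= expR (infconv2 (u z) (u (flip z i))).
  (* The [th] that is optimal for the averaged values [u] is merely a competitor inside the mean,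
     which is the favourable direction. Convexity of [exp] then separates the two terms, and the
     induction hypothesis applies to each. *)
  have [th t01 ->] := infconv2_attained (u z) (u (flip z i)).
  pose c := (1 - th) * u z + th * u (flip z i) + th ^+ 2 / 16.
  rewrite -/c.
  have : Es p s (fun y => expR (infconv2 (infconv s f y) (infconv s f (flip y i)))) z <=
      Es p s (fun y => expR c * ((1 - th) * expR (infconv s f y - u z) +
        th * expR (infconv s f (flip y i) - u (flip z i)))) z.
    apply: ler_Es => // y.
    have := expR_convex_comb (infconv s f y - u z) (infconv s f (flip y i) - u (flip z i)) t01.
    move/(ler_wpM2l (expR_ge0 c)); apply: le_trans.
    rewrite -expRD ler_expR.
    have := infconv2_le (infconv s f y) (infconv s f (flip y i)) t01.
    by rewrite /c; lra.
  move/le_trans; apply; rewrite EsZ EsD !EsZ.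
  rewrite (@Es_flip s i (fun y => expR (infconv s f y - u (flip z i)))) //.
  rewrite -[leRHS]mulr1; apply: ler_wpM2l; first exact: expR_ge0.
  have h1 := IHu z; have h2 := IHu (flip z i).
  case/andP: t01 => t0 t1; have t1' : 0 <= 1 - th by lra.
  have := ler_wpM2l t0 h2; have := ler_wpM2l t1' h1; lra.
have k1 := key (upd x i true); have k0 := key (upd x i false).
rewrite !flip_upd /= in k1 k0; rewrite !Eu.
case/andP: p01 => p0 p1; have q0 : 0 <= 1 - p by lra.
set a := u _ in k1 k0 *; set b := u (upd x i false) in k1 k0 *.
apply: (@le_trans _ _ ((p * expR (infconv2 a b) + (1 - p) * expR (infconv2 b a)) *
   (p * expR (- a) + (1 - p) * expR (- b)))).
  apply: ler_wpM2r.
    by apply: addr_ge0; apply: mulr_ge0 => //; exact: expR_ge0.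
  by apply: lerD; apply: ler_wpM2l.
have [ab|/ltW ba] := leP a b; first by apply: two_point_transport_le => //; ring.
rewrite addrC [X in _ * X]addrC; apply: two_point_transport_le => //; ring.
Qed.

(** Flipping coordinate [i] lowers the available bound [c] by at most [al i], and [infconv2_ge]
    turns that into a loss of [4 (al i)^2]; the losses add up along [s]. The weights are attached to
    the base point [x] alone. *)
Lemma infconv_ge s f x (al : I -> R) c : uniq s ->
  (forall y : {ffun I -> bool}, (forall i, i \notin s -> y i = x i) ->
     c - \sum_(i <- s) al i * (x i != y i)%:R <= f y) ->
  c - 4 * \sum_(i <- s) al i ^+ 2 <= infconv s f x.
Proof.
elim: s x c => [|i s IH] x c /=.
  by move=> _ /(_ x (fun _ _ => erefl)); rewrite !big_nil mulr0.
case/andP=> nis us H; rewrite big_cons.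
have -> : c - 4 * (al i ^+ 2 + \sum_(j <- s) al j ^+ 2) =
   (c - 4 * \sum_(j <- s) al j ^+ 2) - 4 * al i ^+ 2 by ring.
apply: infconv2_ge.
  apply: IH => // y yx; have := H y; rewrite big_cons yx //.
  rewrite eqxx mulr0 add0r; apply=> j; rewrite inE negb_or => /andP[_]; exact: yx.
have -> : c - 4 * \sum_(j <- s) al j ^+ 2 - al i =
  (c - al i) - 4 * \sum_(j <- s) al j ^+ 2 by ring.
apply: IH => // y yx; have := H y; rewrite big_cons yx // !ffunE eqxx.
have -> : (x i != ~~ x i) by case: (x i).
rewrite mulr1 opprD addrA.
rewrite (eq_big_seq (fun j => al j * (flip x i j != y j)%:R)); last first.
  move=> j js; rewrite !ffunE.
  by have -> : (j == i) = false by apply: contraNF nis => /eqP <-.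
apply=> j; rewrite inE negb_or => /andP[ji js].
by rewrite yx // !ffunE (negbTE ji).
Qed.

(* [al x] plays the role of a one-sided gradient of [Z] at [x]. *)
Lemma Es_transport s (Z : {ffun I -> bool} -> R) (al : {ffun I -> bool} -> I -> R) x :
  uniq s -> (forall i, i \in s) ->
  (forall x y, Z x - Z y <= \sum_(i <- s) al x i * (x i != y i)%:R) ->
  Es p s (fun y => expR (Z y - 4 * \sum_(i <- s) al y i ^+ 2)) x *
  Es p s (fun y => expR (- Z y)) x <= 1.
Proof.
move=> us s_all H; apply: le_trans (Es_infconv Z x us).
apply: ler_wpM2r; first by apply: Es_ge0 => // y; exact: expR_ge0.
apply: ler_Es => // y; rewrite ler_expR; apply: infconv_ge => // z _.
have := H y z; lra.
Qed.

End Transport.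

(** * Perron vectors *)

Lemma continuous_bigsum (R : realType) (V : topologicalType) (J : finType)
    (F : J -> V -> R) : (forall j, continuous (F j)) ->
  continuous (fun v => \sum_j F j v).
Proof.
move=> cF; elim: (index_enum J) => [|j s IH] v.
  have -> : (fun v => \sum_(j <- [::]) F j v) = (fun=> 0) by apply/funext => z; rewrite big_nil.
  exact: cvg_cst.
have -> : (fun v => \sum_(k <- j :: s) F k v) = (fun v => F j v + \sum_(k <- s) F k v).
  by apply/funext => z; rewrite big_cons.
exact: (continuousD (cF j v) (IH v)).
Qed.

Section Norms.
Variables (R : realType) (n : nat).
Implicit Types (A : 'M[R]_n) (x u v : 'cV[R]_n).

Lemma sum_sqr_ge0 x : 0 <= \sum_i x i 0 ^+ 2.
Proof. by apply: sumr_ge0 => i _; exact: sqr_ge0. Qed.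

Lemma l2norm_ge0 x : 0 <= l2norm x.
Proof. exact: sqrtr_ge0. Qed.

Lemma l2norm_sqr x : l2norm x ^+ 2 = \sum_i x i 0 ^+ 2.
Proof. by rewrite sqr_sqrtr // sum_sqr_ge0. Qed.

Lemma l2norm_le1 x : (l2norm x <= 1) = (\sum_i x i 0 ^+ 2 <= 1).
Proof. by rewrite -l2norm_sqr expr_le1 // l2norm_ge0. Qed.

Lemma spectral_norm_attained A :
  exists2 x, l2norm x <= 1 &
    l2norm (A *m x) = spectral_norm A /\
    forall u, l2norm u <= 1 -> l2norm (A *m u) <= spectral_norm A.
Proof.
pose q (r : 'rV[R]_n) := \sum_j r 0 j ^+ 2.
pose f (r : 'rV[R]_n) := l2norm (A *m r^T).
pose K := [set r : 'rV[R]_n | q r <= 1].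
have sqc (F : 'rV[R]_n -> R) : continuous F -> continuous (fun r => F r ^+ 2).
  move=> cF r.
  have -> : (fun r => F r ^+ 2) = (fun r => F r * F r) by apply/funext => z; rewrite expr2.
  exact: (continuousM (cF r) (cF r)).
have cq : continuous q.
  by apply: continuous_bigsum => j; apply: sqc; exact: coord_continuous.
have cf : continuous f.
  move=> r; rewrite /f /l2norm.
  apply: (@continuous_comp _ _ _ (fun r : 'rV[R]_n => \sum_i (A *m r^T) i 0 ^+ 2) Num.sqrt);
    last exact: sqrt_continuous.
  apply: continuous_bigsum => i; apply: sqc.
  have -> : (fun r : 'rV[R]_n => (A *m r^T) i 0) = (fun r => \sum_j A i j * r 0 j).
    by apply/funext => z; rewrite mxE; apply: eq_bigr => j _; rewrite mxE.
  apply: continuous_bigsum => j z.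
  exact: (continuousM (@cst_continuous _ _ (A i j) z) (@coord_continuous R 1 n 0 j z)).
have K0 : K !=set0.
  by exists 0; rewrite /K /= /q big1 // => j _; rewrite mxE expr0n.
have cK : compact K.
  apply: bounded_closed_compact.
    exists 1; split => // M M1 r Kr /=.
    rewrite [leLHS]/Num.Def.normr /= mx_normrE; apply/bigmax_leP; split; first by rewrite ltW // (lt_trans ltr01).
    move=> [i j] _ /=; rewrite (ord1 i); apply: le_trans (ltW M1).
    rewrite -(@expr_le1 _ 2) // real_normK ?num_real //.
    apply: le_trans Kr; rewrite /q (bigD1 j) //= lerDl.
    by apply: sumr_ge0 => k _; exact: sqr_ge0.
  have -> : K = q @^-1` [set t : R | t <= 1] by [].
  by apply: closed_comp => [r _|]; [exact: cq | exact: closed_le].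
have [c Kc cmax] := @compact_EVT_max _ R f K K0 cK (continuous_subspaceT cf).
rewrite inE in Kc.
have qT (r : 'rV[R]_n) : (l2norm r^T <= 1) = (q r <= 1).
  by rewrite l2norm_le1 /q; under eq_bigr do rewrite mxE.
have cb u : l2norm u <= 1 -> l2norm (A *m u) <= f c.
  by move=> u1; have := cmax u^T; rewrite /f trmxK; apply; rewrite inE /K /= -qT trmxK.
have E : spectral_norm A = f c.
  apply/eqP; rewrite eq_le; apply/andP; split.
    apply: ge_sup; first by exists (f c); exists c^T => //; rewrite /= qT.
    by move=> _ [u u1 <-]; exact: cb.
  apply: ub_le_sup; first by exists (f c) => _ [u u1 <-]; exact: cb.
  by exists c^T => //; rewrite /= qT.
exists c^T; first by rewrite qT.
by rewrite E; split.
Qed.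

Lemma spectral_norm_ge0 A : 0 <= spectral_norm A.
Proof. by have [x _ [<- _]] := spectral_norm_attained A; exact: l2norm_ge0. Qed.

Lemma sqr_sum_mul_le (J : finType) (a b : J -> R) :
  (\sum_j a j * b j) ^+ 2 <= (\sum_j a j ^+ 2) * (\sum_j b j ^+ 2).
Proof.
set A := \sum_j a j ^+ 2; set B := \sum_j b j ^+ 2; set C := \sum_j a j * b j.
have A0 : 0 <= A by apply: sumr_ge0 => j _; exact: sqr_ge0.
have H t : 0 <= A * t ^+ 2 - 2 * C * t + B.
  have -> : A * t ^+ 2 - 2 * C * t + B = \sum_j (a j * t - b j) ^+ 2.
    rewrite /A /B /C mulr_suml mulr_sumr mulr_suml -sumrB -big_split /=.
    by apply: eq_bigr => j _; ring.
  by apply: sumr_ge0 => j _; exact: sqr_ge0.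
have [A0'|A1] := eqVneq A 0.
  have C0 : C = 0.
    rewrite /C big1 // => j _.
    move/eqP: A0'; rewrite psumr_eq0; last by move=> k _; exact: sqr_ge0.
    by move/allP/(_ j (mem_index_enum _)); rewrite sqrf_eq0 => /eqP ->; rewrite mul0r.
  by rewrite C0 A0' expr0n mul0r.
have Ap : 0 < A by rewrite lt_def A1.
have := H (C / A); have -> : A * (C / A) ^+ 2 - 2 * C * (C / A) + B = (A * B - C ^+ 2) / A by field.
by rewrite pmulr_lge0 ?invr_gt0 // subr_ge0.
Qed.

Lemma quad_form_le A u : \sum_i u i 0 ^+ 2 <= 1 ->
  \sum_i \sum_j u i 0 * A i j * u j 0 <= spectral_norm A.
Proof.
move=> u1; have [_ _ [_ /(_ u)]] := spectral_norm_attained A.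
rewrite l2norm_le1 => /(_ u1) H.
have -> : \sum_i \sum_j u i 0 * A i j * u j 0 = \sum_i u i 0 * (A *m u) i 0.
  by apply: eq_bigr => i _; rewrite mxE mulr_sumr; apply: eq_bigr => j _; rewrite mulrA.
apply: le_trans H; apply: le_trans (ler_norm _) _.
rewrite -(ler_pXn2r (n := 2)) ?nnegrE ?l2norm_ge0 //.
rewrite real_normK ?num_real // l2norm_sqr.
apply: le_trans (sqr_sum_mul_le _ _) _.
by rewrite -[leRHS]mul1r; apply: ler_wpM2r => //; exact: sum_sqr_ge0.
Qed.

Lemma l2norm_mulmx_le A u : l2norm (A *m u) <= spectral_norm A * l2norm u.
Proof.
have [_ _ [_ H]] := spectral_norm_attained A.
have [u0|u0] := eqVneq (l2norm u) 0.
  have -> : u = 0.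
    apply/matrixP => i j; rewrite (ord1 j) mxE.
    have := l2norm_sqr u; rewrite u0 expr0n /= => /esym/eqP.
    rewrite psumr_eq0; last by move=> k _; exact: sqr_ge0.
    by move/allP/(_ i (mem_index_enum _)); rewrite sqrf_eq0 => /eqP.
  rewrite mulmx0 [X in X <= _](_ : _ = 0); first by apply: mulr_ge0; [exact: spectral_norm_ge0 | exact: l2norm_ge0].
  by rewrite /l2norm big1 ?sqrtr0 // => i _; rewrite mxE expr0n.
have up : 0 < l2norm u by rewrite lt_def u0 l2norm_ge0.
have nZ c (w : 'cV[R]_n) : 0 <= c -> l2norm (c *: w) = c * l2norm w.
  move=> c0; rewrite /l2norm (eq_bigr (fun i => c ^+ 2 * w i 0 ^+ 2)); last by move=> i _; rewrite mxE exprMn.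
  by rewrite -mulr_sumr sqrtrM ?sqr_ge0 // sqrtr_sqr ger0_norm.
have ci : 0 <= (l2norm u)^-1 by rewrite invr_ge0 ltW.
have := H ((l2norm u)^-1 *: u); rewrite nZ // mulVf // lexx => /(_ isT).
by rewrite -scalemxAr nZ // mulrC ler_pdivrMr.
Qed.

End Norms.

(** Replacing a maximiser by its absolute value [w] keeps it a maximiser. Without irreducibility,
    [- Z] may be an eigenvalue too, so [w] need only be an eigenvector of [A^2]; adding [A w] and
    [Z w] projects it to the eigenvalue [Z] and preserves nonnegativity. *)
Lemma perron_vector (R : realType) (n : nat) (A : 'M[R]_n.+1) :
  (forall i j, 0 <= A i j) -> (forall i j, A i j = A j i) ->
  exists v : 'cV[R]_n.+1, [/\ forall i, 0 <= v i 0, \sum_i v i 0 ^+ 2 = 1 &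
    forall i, \sum_j A i j * v j 0 = spectral_norm A * v i 0].
Proof.
move=> A0 Asym; set Z := spectral_norm A.
have Z0 : 0 <= Z := spectral_norm_ge0 A.
have main : exists2 u : 'cV[R]_n.+1, (forall i, 0 <= u i 0) & u != 0 /\ A *m u = Z *: u.
  have [Zeq|Zne] := eqVneq Z 0.
    (* If the norm is 0, the vector [A w + Z w] would vanish; but [A] then kills every vector. *)
    exists (const_mx 1); first by move=> i; rewrite mxE.
    split; first by apply/eqP => /matrixP/(_ ord0 0)/eqP; rewrite !mxE oner_eq0.
    rewrite Zeq scale0r; apply/matrixP => i j; rewrite (ord1 j) [RHS]mxE.
    have := l2norm_mulmx_le A (const_mx 1); rewrite -/Z Zeq mul0r => h.
    have : l2norm (A *m const_mx 1) = 0 by apply/eqP; rewrite eq_le h l2norm_ge0.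
    move=> h0; have := l2norm_sqr (A *m const_mx 1); rewrite h0 expr0n /= => /esym/eqP.
    rewrite psumr_eq0; last by move=> k _; exact: sqr_ge0.
    by move/allP/(_ i (mem_index_enum _)); rewrite sqrf_eq0 => /eqP.
  have Zp : 0 < Z by rewrite lt_def Zne.
  have [x x1 [xZ _]] := spectral_norm_attained A; rewrite -/Z in xZ.
  pose w : 'cV[R]_n.+1 := \col_i `|x i 0|.
  have w0 i : 0 <= w i 0 by rewrite mxE.
  have wx : l2norm w = l2norm x.
    by rewrite /l2norm; congr Num.sqrt; apply: eq_bigr => i _; rewrite mxE real_normK ?num_real.
  have wZ : l2norm (A *m w) = Z.
    apply/eqP; rewrite eq_le; apply/andP; split.
      by apply: le_trans (l2norm_mulmx_le A w) _; rewrite wx -/Z; apply: ler_piMr.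
    rewrite -xZ /l2norm; apply: ler_wsqrtr; apply: ler_sum => i _.
    rewrite -[leLHS]real_normK ?num_real //; apply: lerXn2r; rewrite ?nnegrE //.
      by rewrite mxE sumr_ge0 // => j _; rewrite mulr_ge0.
    rewrite !mxE; apply: le_trans (ler_norm_sum _ _ _) _.
    by apply: ler_sum => j _; rewrite normrM mxE (ger0_norm (A0 i j)).
  have w1 : l2norm w = 1.
    apply/eqP; rewrite eq_le wx x1 /=.
    by have := l2norm_mulmx_le A w; rewrite wZ -/Z wx; rewrite -{1}[Z]mulr1 ler_pM2l.
  pose y := A *m w.
  have AyZ : A *m y = (Z ^+ 2) *: w.
    have yn : \sum_i y i 0 ^+ 2 = Z ^+ 2 by rewrite -l2norm_sqr wZ.
    have dotE : \sum_i (A *m y) i 0 * w i 0 = Z ^+ 2.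
      rewrite -yn; under eq_bigr do rewrite mxE mulr_suml.
      rewrite exchange_big /=; apply: eq_bigr => j _.
      rewrite expr2 {2}/y mxE mulr_sumr; apply: eq_bigr => i _.
      by rewrite (Asym i j); ring.
    have Ayn : \sum_i (A *m y) i 0 ^+ 2 <= Z ^+ 4.
      rewrite -l2norm_sqr; have := l2norm_mulmx_le A y; rewrite wZ -/Z => h.
      have -> : Z ^+ 4 = (Z * Z) ^+ 2 by ring.
      by apply: lerXn2r; rewrite ?nnegrE ?l2norm_ge0 ?mulr_ge0.
    have wn : \sum_i w i 0 ^+ 2 = 1 by rewrite -l2norm_sqr w1 expr1n.
    (* Equality case of Cauchy-Schwarz: the square expands to at most [Z^4 - 2 Z^4 + Z^4]. *)
    have D0 : \sum_i ((A *m y) i 0 - Z ^+ 2 * w i 0) ^+ 2 <= 0.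
      have -> : \sum_i ((A *m y) i 0 - Z ^+ 2 * w i 0) ^+ 2 =
         \sum_i (A *m y) i 0 ^+ 2 - 2 * Z ^+ 2 * \sum_i (A *m y) i 0 * w i 0 +
         Z ^+ 4 * \sum_i w i 0 ^+ 2.
        by rewrite !mulr_sumr -sumrB -big_split /=; apply: eq_bigr => i _; ring.
      rewrite dotE wn; move: Ayn; set S := \sum_i _; lra.
    apply/matrixP => i j; rewrite (ord1 j) [RHS]mxE; apply/eqP; rewrite -subr_eq0 -sqrf_eq0.
    have /eqP : \sum_i ((A *m y) i 0 - Z ^+ 2 * w i 0) ^+ 2 = 0.
      by apply/eqP; rewrite eq_le D0 sumr_ge0 // => k _; exact: sqr_ge0.
    rewrite psumr_eq0; last by move=> k _; exact: sqr_ge0.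
    by move/allP/(_ i (mem_index_enum _)).
  exists (y + Z *: w).
    move=> i; rewrite !mxE; apply: addr_ge0; last by apply: mulr_ge0.
    by apply: sumr_ge0 => j _; apply: mulr_ge0.
  split.
    apply/eqP => /matrixP u0.
    have wz i : w i 0 = 0.
      have := u0 i 0; rewrite !mxE => /eqP; rewrite paddr_eq0; last 2 first.
      - by apply: sumr_ge0 => j _; apply: mulr_ge0 => //; exact: w0.
      - by apply: mulr_ge0.
      by case/andP => _; rewrite mulf_eq0 (negbTE Zne) /= => /eqP.
    by move/eqP: w1; rewrite /l2norm big1 ?sqrtr0 ?(eq_sym 0) ?oner_eq0 // => i _; rewrite wz expr0n.
  rewrite mulmxDr AyZ -scalemxAr -/y scalerDr scalerA -expr2; exact: addrC.
have [u u0 [une Au]] := main.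
have nu : 0 < l2norm u.
  rewrite lt_def l2norm_ge0 andbT; apply: contra_neq une => un.
  apply/matrixP => i j; rewrite (ord1 j) [RHS]mxE.
  have := l2norm_sqr u; rewrite un expr0n /= => /esym/eqP.
  rewrite psumr_eq0; last by move=> k _; exact: sqr_ge0.
  by move/allP/(_ i (mem_index_enum _)); rewrite sqrf_eq0 => /eqP.
exists ((l2norm u)^-1 *: u); split.
- by move=> i; rewrite mxE mulr_ge0 // invr_ge0 ltW.
- under eq_bigr do rewrite mxE exprMn.
  by rewrite -mulr_sumr -l2norm_sqr -exprMn mulVf ?expr1n // gt_eqF.
- move=> i; under eq_bigr do rewrite mxE mulrCA.
  rewrite -mulr_sumr [in RHS]mxE mulrCA; congr (_ * _).
  by move/matrixP: Au => /(_ i 0); rewrite !mxE.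
Qed.

(** * Delocalization on expanding graphs *)

(** Used in contrapositive form: if every vertex of [S] has at least [rho D] neighbours in [T], then
    [T] is either a proportion [rho / 16] of all vertices or more than [th] times larger than
    [S]. *)
Definition expanding (R : realType) (n : nat) (A : 'M[R]_n) (D rho th : R) : Prop :=
  forall S T : {set 'I_n}, S != finset.set0 ->
    #|T|%:R <= rho * n%:R / 16 -> #|T|%:R <= th * #|S|%:R ->
    \sum_(i in S) \sum_(j in T) A i j < rho * #|S|%:R * D.

Section Delocalization.
Variables (R : realType) (n : nat) (A : 'M[R]_n) (v : 'I_n -> R) (lam D de : R).
Hypothesis A0 : forall i j, 0 <= A i j.
Hypothesis v0 : forall i, 0 <= v i.
Hypothesis Av : forall i, \sum_j A i j * v j = lam * v i.
Hypothesis D0 : 0 < D.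
Hypothesis de01 : 0 <= de <= 1.
Hypothesis degA : forall i, \sum_j A i j <= (1 + de) * D.
Hypothesis lam_ge : (1 - de) * D <= lam.

Let level (g : R) : {set 'I_n} := [set j | g <= v j]%SET.

(** In the eigenvalue equation at [i], a neighbour outside the lower level set contributes at most
    [M - g'] and one inside at most [M]. Hence [lam * v i <= (M - g') * degree + g' * e]; since
    [lam] is almost [D] and the degree is hardly more than [D], [e] must be large. The errors cost
    [2 de M]. *)
Lemma level_degree (M g g' rho : R) (i : 'I_n) :
  (forall j, v j <= M) -> 0 <= g -> 0 < g' -> g <= M -> g' <= M ->
  g + 2 * de * M <= (1 - rho) * g' -> M - g <= v i ->
  rho * D <= \sum_(j in level (M - g')) A i j.
Proof.
case/andP: de01 => de0 de1 vM g0 g'0 gM g'M hrho vi.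
set e := \sum_(j in _) _.
have up : lam * v i <= (M - g') * ((1 + de) * D) + g' * e.
  apply: (@le_trans _ _ ((M - g') * \sum_j A i j + g' * e)); last first.
    by rewrite lerD2r; apply: ler_wpM2l => //; rewrite subr_ge0.
  rewrite -Av mulr_sumr /e mulr_sumr [X in _ + X]big_mkcond -big_split /=.
  apply: ler_sum => j _; rewrite inE; have a0 := A0 i j.
  case: ifPn => [_|]; first by have := vM j; nra.
  by rewrite -ltNge => /ltW h; rewrite addr0 mulrC; apply: ler_wpM2r.
have lo : (1 - de) * D * (M - g) <= lam * v i.
  apply: (@le_trans _ _ ((1 - de) * D * v i)).
    by apply: ler_wpM2l => //; apply: mulr_ge0; [lra | exact: ltW].
  by apply: ler_wpM2r.
rewrite -(ler_pM2l g'0); move: (le_trans lo up) => h.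
have h1 : 0 <= de * D * (g + g').
  by apply: mulr_ge0; [apply: mulr_ge0 => //; exact: ltW | lra].
have h2 := ler_wpM2r (ltW D0) hrho.
nra.
Qed.

Lemma level_edges (M g g' rho : R) :
  (forall j, v j <= M) -> 0 <= g -> 0 < g' -> g <= M -> g' <= M ->
  g + 2 * de * M <= (1 - rho) * g' ->
  rho * #|level (M - g)|%:R * D <=
    \sum_(i in level (M - g)) \sum_(j in level (M - g')) A i j.
Proof.
move=> vM g0 g'0 gM g'M hrho.
rewrite mulrAC -[X in X * _]mulr1 -mulrA mul1r mulr_natr -sumr_const.
by apply: ler_sum => i; rewrite inE => vi; apply: (@level_degree M g g' rho).
Qed.

Lemma delocalization (l : nat) (th : R) (i0 : 'I_n) :
  (0 < l)%N -> de = (16 * l%:R)^-1 -> 1 <= th -> n%:R <= th ^+ l ->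
  expanding A D (2 * l%:R)^-1 th -> expanding A D (1/2) l%:R ->
  \sum_i v i ^+ 2 = 1 -> (forall j, v j <= v i0) ->
  n%:R * v i0 ^+ 2 <= 512.
Proof.
move=> l0 deE th1 thl ex1 ex2 v1 vM; set M := v i0.
have n0 : 0 < n%:R :> R by rewrite ltr0n (leq_ltn_trans _ (ltn_ord i0)).
have L0 : 1 <= l%:R :> R by rewrite ler1n.
have Lp : 0 < l%:R :> R by rewrite ltr0n.
have de16 : de * l%:R = 1 / 16 by rewrite deE; field; rewrite gt_eqF.
have dep : 0 < de by rewrite deE invr_gt0 mulr_gt0.
have M0 : 0 < M.
  rewrite lt_def v0 andbT; apply/eqP => Mz.
  move: v1; rewrite big1 => [/eqP|j _]; first by rewrite eq_sym oner_eq0.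
  have := vM j; rewrite -/M Mz => vj; have -> : v j = 0 by apply/eqP; rewrite eq_le vj v0.
  by rewrite expr0n.
set rho := (2 * l%:R)^-1 in ex1.
have rhoE : rho * l%:R = 1 / 2 by rewrite /rho; field; rewrite gt_eqF.
have rho0 : 0 < rho by rewrite invr_gt0 mulr_gt0.
have rho1 : rho <= 1 by nra.
(* Steps of [4 de M = M / (4 l)]: after [l] of them the threshold is [3 M / 4]. From level [k] to
   level [k + 1] the gap condition reads [rho (k + 1) <= 1/2], which is why [rho = 1 / (2 l)]. *)
pose S k := level (M - 4 * de * k%:R * M).
have grow k : (k <= l)%N -> rho * n%:R / 16 < #|S k|%:R \/ th ^+ k <= #|S k|%:R.
  elim: k => [_|k IH kl].
    right; rewrite expr0 ler1n card_gt0; apply/set0Pn; exists i0.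
    by rewrite inE mulr0 mul0r subr0.
  have {}IH := IH (ltnW kl).
  have Sk0 : 0 < #|S k|%:R :> R.
    case: IH => h; first by apply: le_lt_trans h; rewrite divr_ge0 // mulr_ge0 // ltW.
    by apply: lt_le_trans h; apply: exprn_gt0; lra.
  have [T1|T1] := leP #|S k.+1|%:R (rho * n%:R / 16); last by left.
  have [T2|T2] := leP #|S k.+1|%:R (th * #|S k|%:R); last first.
    case: IH => h.
      have : #|S k|%:R <= th * #|S k|%:R by rewrite ler_peMl // ltW.
      by move=> h2; exfalso; lra.
    right; rewrite exprS; apply: le_trans (ltW T2).
    by apply: ler_wpM2l => //; lra.
  have Skn : S k != finset.set0 by rewrite -card_gt0 -(ltr0n R).
  have := ex1 _ _ Skn T1 T2; rewrite ltNge => /negP[].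
  have kl' : k%:R + 1 <= l%:R :> R by rewrite natr1 ler_nat.
  have k0 : 0 <= k%:R :> R by [].
  have b1 : de * k%:R <= 1 / 16 by rewrite -de16; apply: ler_wpM2l; [exact: ltW | lra].
  have b2 : de * (k%:R + 1) <= 1 / 16 by rewrite -de16; apply: ler_wpM2l; [exact: ltW | lra].
  have b3 : rho * (k%:R + 1) <= 1 / 2 by rewrite -rhoE; apply: ler_wpM2l; [exact: ltW | lra].
  have dM : 0 < de * M by apply: mulr_gt0.
  apply: level_edges => //.
  - by apply: mulr_ge0; [apply: mulr_ge0 => //; apply: mulr_ge0; lra | exact: ltW].
  - by apply: mulr_gt0 => //; apply: mulr_gt0; [lra | rewrite ltr0n].
  - by have := ler_wpM2r (ltW M0) b1; lra.
  - by rewrite -natr1; have := ler_wpM2r (ltW M0) b2; lra.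
  - rewrite -natr1; have := ler_wpM2r (ltW dM) b3; lra.
have Sl : rho * n%:R / 16 < #|S l|%:R.
  case: (grow l (leqnn _)) => // h; apply: lt_le_trans h; apply: lt_le_trans thl.
  have := ler_wpM2r (ltW n0) rho1; lra.
have Sl0 : S l != finset.set0.
  rewrite -card_gt0 -(ltr0n R); apply: le_lt_trans Sl.
  by rewrite divr_ge0 // mulr_ge0 // ltW.
(* One long step, from [3 M / 4] down to [M / 4]. Its gap is a constant fraction of [M], so
   expansion with [rho = 1/2] applies and raises the size from [n / (32 l)] to [n / 32]. *)
pose T := level (M - 3/4 * M).
have Tbig : n%:R / 32 < #|T|%:R :> R.
  rewrite ltNge; apply/negP => T1.
  have T2 : #|T|%:R <= l%:R * #|S l|%:R :> R.
    apply: le_trans T1 _; have := ler_wpM2l (ltW Lp) (ltW Sl).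
    have -> : l%:R * (rho * n%:R / 16) = (rho * l%:R) * n%:R / 16 by ring.
    rewrite rhoE; lra.
  have T1' : #|T|%:R <= 1/2 * n%:R / 16 :> R by lra.
  have := ex2 _ _ Sl0 T1' T2; rewrite ltNge => /negP[].
  have E : 4 * de * l%:R * M = 1/4 * M by rewrite -(mulrA 4) de16; lra.
  have d8 : de <= 1 / 16 by rewrite -de16 ler_peMr // ltW.
  have := ler_wpM2r (ltW M0) d8 => dM.
  by apply: level_edges => //; rewrite ?E; lra.
(* More than [n / 32] vertices carry at least [M^2 / 16] of the unit mass; hence [512 = 32 * 16]. *)
have : #|T|%:R * (M / 4) ^+ 2 <= 1.
  rewrite -[leRHS]v1 mulr_natl -sumr_const big_mkcond /=.
  apply: ler_sum => j _; rewrite inE; case: ifPn => [h|_]; last exact: sqr_ge0.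
  by apply: lerXn2r; rewrite ?nnegrE //; lra.
have M2 : 0 < (M / 4) ^+ 2 by apply: exprn_gt0; lra.
have := ler_wpM2r (ltW M2) (ltW Tbig); lra.
Qed.

(** The left side is half of [|al|^2]. Taking out [M^2] leaves the quadratic form, equal to [lam],
    and the eigenvalue equation at [i0] bounds [lam] by the maximal degree. *)
Lemma quartic_form_le (i0 : 'I_n) : (forall j, v j <= v i0) ->
  \sum_i v i ^+ 2 = 1 ->
  \sum_i \sum_j v i ^+ 2 * A i j * v j ^+ 2 <= v i0 ^+ 2 * (2 * D).
Proof.
move=> vM v1.
have M0 : 0 < v i0.
  rewrite lt_def v0 andbT; apply/eqP => Mz.
  move: v1; rewrite big1 => [/eqP|j _]; first by rewrite eq_sym oner_eq0.
  have := vM j; rewrite Mz => vj; have -> : v j = 0 by apply/eqP; rewrite eq_le vj v0.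
  by rewrite expr0n.
have lamD : lam <= 2 * D.
  rewrite -(ler_pM2r M0) -Av.
  apply: (@le_trans _ _ (\sum_j A i0 j * v i0)).
    by apply: ler_sum => j _; apply: ler_wpM2l.
  rewrite -mulr_suml; apply: ler_wpM2r => //.
  apply: le_trans (degA i0) _; case/andP: de01 => _ de1.
  by apply: ler_wpM2r; [exact: ltW | lra].
apply: (@le_trans _ _ (v i0 ^+ 2 * lam)); last by apply: ler_wpM2l => //; exact: sqr_ge0.
have -> : v i0 ^+ 2 * lam = v i0 ^+ 2 * \sum_i \sum_j v i * A i j * v j.
  congr (_ * _); rewrite -[LHS]mulr1 -v1 mulr_sumr; apply: eq_bigr => i _.
  rewrite expr2 mulrA -Av mulr_suml; apply: eq_bigr => j _; ring.
rewrite mulr_sumr; apply: ler_sum => i _; rewrite mulr_sumr; apply: ler_sum => j _.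
have -> : v i ^+ 2 * A i j * v j ^+ 2 = (v i * v j) * (v i * A i j * v j) by ring.
apply: ler_wpM2r; first by apply: mulr_ge0 => //; apply: mulr_ge0.
by rewrite expr2; apply: ler_pM.
Qed.

End Delocalization.

(** * Random graphs *)

Definition edge (n : nat) : finType := {e : 'I_n * 'I_n | (e.1 < e.2)%N}.

Definition edge_bit (n : nat) (x : {ffun edge n -> bool}) (q : 'I_n * 'I_n) : bool :=
  if insub q is Some e then x e else false.

Definition graph_mx (R : realType) (n : nat) (x : {ffun edge n -> bool}) : 'M[R]_n :=
  \matrix_(i, j) ((edge_bit x (i, j))%:R + (edge_bit x (j, i))%:R).

Lemma edge_bit_val n (x : {ffun edge n -> bool}) (e : edge n) : edge_bit x (val e) = x e.
Proof. by rewrite /edge_bit valK. Qed.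

Lemma edge_bit_ge n (x : {ffun edge n -> bool}) (i j : 'I_n) : (j <= i)%N ->
  edge_bit x (i, j) = false.
Proof. by move=> ji; rewrite /edge_bit insubF //= ltnNge ji. Qed.

Section GraphMatrix.
Variables (R : realType) (n : nat).
Implicit Types (x y : {ffun edge n -> bool}).

Lemma graph_mx_ge0 x i j : 0 <= graph_mx R x i j.
Proof. by rewrite mxE addr_ge0. Qed.

Lemma graph_mx_le1 x i j : graph_mx R x i j <= 1.
Proof.
rewrite mxE; case: (leqP i j) => ij.
  by rewrite (edge_bit_ge x ij) addr0; case: edge_bit.
by rewrite (edge_bit_ge x (ltnW ij)) add0r; case: edge_bit.
Qed.

Lemma graph_mx_sym x i j : graph_mx R x i j = graph_mx R x j i.
Proof. by rewrite !mxE addrC. Qed.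

Lemma sum_graph_mx (c : 'I_n -> 'I_n -> R) x :
  \sum_i \sum_j c i j * graph_mx R x i j =
  \sum_(e : edge n) (c (val e).1 (val e).2 + c (val e).2 (val e).1) * (x e)%:R.
Proof.
transitivity (\sum_i \sum_j (c i j + c j i) * (edge_bit x (i, j))%:R).
  rewrite (eq_bigr (fun i => \sum_j c i j * (edge_bit x (i, j))%:R +
      \sum_j c i j * (edge_bit x (j, i))%:R)); last first.
    by move=> i _; rewrite -big_split /=; apply: eq_bigr => j _; rewrite mxE mulrDr.
  rewrite big_split /= [X in _ + X]exchange_big -big_split /=.
  apply: eq_bigr => i _; rewrite -big_split /=; apply: eq_bigr => j _; ring.
rewrite pair_big /= (bigID (fun q : 'I_n * 'I_n => (q.1 < q.2)%N)) /=.
rewrite [X in _ + X]big1 ?addr0; last first.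
  by case=> i j /=; rewrite -leqNgt => ji; rewrite edge_bit_ge // mulr0.
rewrite (reindex_omap (val : edge n -> 'I_n * 'I_n) insub); last first.
  by move=> q qP; rewrite insubT.
apply: eq_big => [e|e _]; first by rewrite valK eqxx (valP e).
by rewrite -surjective_pairing edge_bit_val.
Qed.

(** Obtained by evaluating [sum_graph_mx] at the complete graph. *)
Lemma sum_edges (c : 'I_n -> 'I_n -> R) :
  \sum_(e : edge n) (c (val e).1 (val e).2 + c (val e).2 (val e).1) =
  \sum_i \sum_(j | j != i) c i j.
Proof.
have -> : \sum_(e : edge n) (c (val e).1 (val e).2 + c (val e).2 (val e).1) =
  \sum_i \sum_j c i j * graph_mx R [ffun=> true] i j.
  by rewrite sum_graph_mx; apply: eq_bigr => e _; rewrite ffunE mulr1.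
apply: eq_bigr => i _; rewrite [RHS]big_mkcond /=; apply: eq_bigr => j _.
rewrite mxE /edge_bit; case: ifPn => [ji|].
  have [ij|ij] := ltnP i j.
    by rewrite insubT insubF ?ltnNge ?(ltnW ij) // ffunE addr0 mulr1.
  have ji' : (j < i)%N by rewrite ltn_neqAle ij andbT.
  by rewrite insubF ?ltnNge ?ij // insubT ffunE add0r mulr1.
by rewrite negbK => /eqP ->; rewrite insubF ?ltnn // addr0 mulr0.
Qed.

(** * Chernoff bounds for edge counts *)

Variable p : R.
Hypothesis p01 : 0 <= p <= 1.
Let E f := Es p (enum (edge n)) f [ffun=> false].

(** An edge carries the weight [c i j + c j i]; the bound 1/4 keeps it below the 1/2 required by
    [Es_expR_sum], and [2 (a + b)^2 <= 4 a^2 + 4 b^2] separates the two orientations again. *)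
Lemma mean_expR_graph (c : 'I_n -> 'I_n -> R) : (forall i j, c i j <= 1/4) ->
  E (fun x => expR (\sum_i \sum_j c i j * graph_mx R x i j)) <=
  expR (p * \sum_i \sum_(j | j != i) (c i j + 4 * c i j ^+ 2)).
Proof.
move=> c4; pose y (e : edge n) := c (val e).1 (val e).2 + c (val e).2 (val e).1.
rewrite /E (@eq_Es _ _ _ _ _ (fun x => expR (\sum_(e <- enum (edge n)) y e * (x e)%:R))); last first.
  by move=> x; rewrite sum_graph_mx big_enum.
apply: le_trans (Es_expR_sum p01 _ (enum_uniq _) _) _.
  by move=> e; have := c4 (val e).1 (val e).2; have := c4 (val e).2 (val e).1; rewrite /y; lra.
rewrite ler_expR; case/andP: p01 => p0 _; apply: ler_wpM2l => //.
rewrite big_enum -(sum_edges (fun i j => c i j + 4 * c i j ^+ 2)) /=.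
apply: ler_sum => e _; rewrite /y.
have := sqr_ge0 (c (val e).1 (val e).2 - c (val e).2 (val e).1); nra.
Qed.

Lemma mean_indicator_le (Q : {ffun edge n -> bool} -> bool) (S : {ffun edge n -> bool} -> R) (a b : R) :
  (forall x, Q x -> a <= S x) -> E (fun x => expR (S x)) <= expR b ->
  E (fun x => (Q x)%:R) <= expR (b - a).
Proof.
move=> QS Eb; apply: (@le_trans _ _ (E (fun x => expR (- a) * expR (S x)))).
  apply: ler_Es => // x; case: (boolP (Q x)) => [/QS h|_]; last by rewrite mulr_ge0 // expR_ge0.
  by rewrite -expRD -[leLHS]expR0 ler_expR; lra.
by rewrite /E EsZ addrC expRD; apply: ler_wpM2l => //; exact: expR_ge0.
Qed.

Let D : R := p * (n%:R - 1).

(** The exponent [D (4 la^2 - la de)] is minimal at [la = de / 8], with value [- de^2 D / 16]. *)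
Lemma prob_high_degree (de : R) (i : 'I_n) : 0 <= de <= 1 ->
  E (fun x => ((1 + de) * D < \sum_j graph_mx R x i j)%R%:R) <= expR (- (de ^+ 2 * D / 16)).
Proof.
case/andP=> d0 d1; pose la := de / 8.
pose c (a b : 'I_n) := if a == i then la else 0.
have sumc x : \sum_a \sum_b c a b * graph_mx R x a b = la * \sum_j graph_mx R x i j.
  rewrite (bigD1 i) //= [X in _ + X]big1 ?addr0.
    by rewrite mulr_sumr; apply: eq_bigr => j _; rewrite /c eqxx.
  by move=> a ai; rewrite big1 // => b _; rewrite /c (negbTE ai) mul0r.
have cnt (a : 'I_n) (t : R) : \sum_(b | b != a) t = (n%:R - 1) * t.
  rewrite sumr_const.
  have -> : #|(fun b : 'I_n => b != a)| = n.-1.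
    have := cardC1 a; rewrite card_ord => <-; apply: eq_card => b; by rewrite !inE.
  have n0 : (0 < n)%N := leq_ltn_trans (leq0n _) (ltn_ord a).
  by rewrite -[LHS]mulr_natl -subn1 natrB.
have c4 a b : c a b <= 1/4 by rewrite /c /la; case: ifP => _; lra.
have {c4} H := mean_expR_graph c4.
rewrite /E (@eq_Es _ _ _ _ _ (fun x => expR (la * \sum_j graph_mx R x i j))) in H; last by move=> x; rewrite sumc.
have S2 : p * \sum_a \sum_(b | b != a) (c a b + 4 * c a b ^+ 2) = D * (la + 4 * la ^+ 2).
  rewrite (bigD1 i) //= [X in _ + X]big1 ?addr0.
    by rewrite (eq_bigr (fun=> la + 4 * la ^+ 2)) ?cnt /D; [ring | move=> b _; rewrite /c eqxx].
  by move=> a ai; rewrite big1 // => b _; rewrite /c (negbTE ai); ring.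
rewrite S2 in H.
apply: le_trans (@mean_indicator_le _ (fun x => la * \sum_j graph_mx R x i j) (la * ((1 + de) * D)) _ _ H) _.
- by move=> x /ltW h; apply: ler_wpM2l => //; rewrite /la; lra.
- by rewrite ler_expR /la; lra.
Qed.

Lemma prob_few_edges (de : R) : 0 <= de <= 1 ->
  E (fun x => (\sum_i \sum_j graph_mx R x i j < (1 - de) * (n%:R * D))%R%:R) <=
  expR (- (de ^+ 2 * (n%:R * D) / 16)).
Proof.
case/andP=> d0 d1; pose la := de / 8.
have c4 (a b : 'I_n) : (fun _ _ => - la) a b <= 1/4 by rewrite /la; lra.
have {c4} H := mean_expR_graph c4.
rewrite /E (@eq_Es _ _ _ _ _ (fun x => expR (- la * \sum_i \sum_j graph_mx R x i j))) in H; last first.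
  by move=> x; rewrite mulr_sumr; congr expR; apply: eq_bigr => i _; rewrite mulr_sumr.
have S2 : p * \sum_(i < n) \sum_(j | j != i) (- la + 4 * (- la) ^+ 2) = n%:R * D * (- la + 4 * la ^+ 2).
  case: (posnP n) => [n0|n0].
    have F (i : 'I_n) : False by have := leq_ltn_trans (leq0n i) (ltn_ord i); rewrite [X in (_ < X)%N]n0.
    by rewrite big1 => [|i]; [rewrite n0 mulr0 !mul0r | case: (F i)].
  rewrite (eq_bigr (fun=> (n%:R - 1) * (- la + 4 * la ^+ 2))).
    by rewrite sumr_const card_ord /D -mulr_natl; ring.
  move=> i _; rewrite sumr_const.
  have -> : #|(fun b : 'I_n => b != i)| = n.-1.
    have := cardC1 i; rewrite card_ord => <-; apply: eq_card => b; by rewrite !inE.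
  by rewrite -[LHS]mulr_natl -subn1 natrB //; ring.
rewrite S2 in H.
apply: le_trans (@mean_indicator_le _ (fun x => - la * \sum_i \sum_j graph_mx R x i j) (- la * ((1 - de) * (n%:R * D))) _ _ H) _.
- by move=> x /ltW h; rewrite !mulNr lerN2; apply: ler_wpM2l => //; rewrite /la; lra.
- by rewrite ler_expR /la; lra.
Qed.

(** Since [T] is small, the expected number of edges is far below the threshold [rho |S| D]; a fixed
    multiplier 1/4 is enough, and the mean consumes only [rho |S| D / 16] of the gain
    [rho |S| D / 4]. *)
Lemma prob_dense_pair (rho : R) (S T : {set 'I_n}) : (2 <= n)%N -> 0 <= rho ->
  #|T|%:R <= rho * n%:R / 16 ->
  E (fun x => (rho * #|S|%:R * D <= \sum_(i in S) \sum_(j in T) graph_mx R x i j)%R%:R) <=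
  expR (- (rho * #|S|%:R * D / 8)).
Proof.
move=> n2 r0 T1; pose c (i j : 'I_n) : R := if (i \in S) && (j \in T) then 1/4 else 0.
have c4 i j : c i j <= 1/4 by rewrite /c; case: ifP => _; lra.
have {c4} H := mean_expR_graph c4.
rewrite /E (@eq_Es _ _ _ _ _ (fun x => expR (1/4 * \sum_(i in S) \sum_(j in T) graph_mx R x i j))) in H; last first.
  move=> x; congr expR; rewrite mulr_sumr [RHS]big_mkcond; apply: eq_bigr => i _.
  rewrite mulr_sumr [in RHS]big_mkcond /=; case: ifP => iS; last first.
    by rewrite big1 // => j _; rewrite /c iS mul0r.
  by apply: eq_bigr => j _; rewrite /c iS; rewrite /=; case: ifP => _; rewrite ?mul0r.
have S2 : \sum_i \sum_(j | j != i) (c i j + 4 * c i j ^+ 2) <= #|S|%:R * #|T|%:R / 2.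
  apply: (@le_trans _ _ (\sum_(i in S) \sum_(j in T) (1 / 2 : R))).
    rewrite [leRHS]big_mkcond; apply: ler_sum => i _; rewrite big_mkcond /=.
    case: ifP => iS; last first.
      by rewrite big1 // => j _; rewrite /c iS /=; case: ifP => // _; ring.
    rewrite [leRHS]big_mkcond /=; apply: ler_sum => j _; rewrite /c iS /=.
    by case: ifP => _; case: ifP => _; lra.
  rewrite le_eqVlt; apply/orP; left; apply/eqP.
  by rewrite !sumr_const -[X in X *+ _]mulr_natl -[LHS]mulr_natl; ring.
case/andP: (p01) => p0 p1.
have n1 : n%:R <= 2 * (n%:R - 1) :> R.
  have : 2 <= n%:R :> R by rewrite ler_nat. by move=> ?; lra.
have H' := le_trans H (_ : _ <= expR (rho * #|S|%:R * D / 16)).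
apply: le_trans (@mean_indicator_le _ (fun x => 1/4 * \sum_(i in S) \sum_(j in T) graph_mx R x i j) (1/4 * (rho * #|S|%:R * D)) _ _ (H' _)) _.
- by move=> x h; apply: ler_wpM2l => //; lra.
- rewrite ler_expR; apply: le_trans (ler_wpM2l p0 S2) _.
  have s0 : 0 <= p * #|S|%:R by rewrite mulr_ge0.
  have h1 : rho * n%:R <= rho * (2 * (n%:R - 1)) by apply: ler_wpM2l.
  have : #|T|%:R <= rho * (n%:R - 1) / 8 by lra.
  move/(ler_wpM2l s0); rewrite /D; lra.
- have n1' : 1 <= n%:R :> R by rewrite ler1n ltnW.
  have : 0 <= rho * #|S|%:R * D by rewrite !mulr_ge0 // subr_ge0.
  by rewrite ler_expR; lra.
Qed.

End GraphMatrix.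

(** * Union bounds for the exceptional graphs *)

Lemma sum_expr_card (R : realType) (n : nat) (a : R) :
  \sum_(S : {set 'I_n}) a ^+ #|S| = (1 + a) ^+ n.
Proof.
rewrite addrC -[X in _ ^+ X](card_ord n) -prodr_const bigA_distr /=.
by apply: eq_bigr => S _; rewrite -big_mkcond /= prodr_const.
Qed.

Section RareEvents.
Variables (R : realType) (n : nat) (p : R).
Hypothesis n2 : (2 <= n)%N.
Hypothesis p01 : 0 <= p <= 1.
Let E f := Es p (enum (edge n)) f [ffun=> false].
Let D : R := p * (n%:R - 1).
Let L : R := ln n%:R.

Lemma mean_degree_ge0 : 0 <= D.
Proof. by case/andP: p01 => p0 _; rewrite mulr_ge0 // subr_ge0 ler1n ltnW. Qed.

(** Union bound over the pairs [(S, T)]. The hypothesis on [th * L] pays for the entropy: as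
    [|T| <= th |S|], both [L |S|] and [L |T|] are at most a quarter of the exponent [rho |S| D / 8]
    of [prob_dense_pair]. *)
Lemma prob_not_expanding (rho th : R) : 0 <= rho -> 1 <= th -> th * L <= rho * D / 32 ->
  E (fun x => (~~ `[< expanding (graph_mx R x) D rho th >])%:R) <= 16 * expR (- (rho * D / 16)).
Proof.
move=> r0 th1 thL.
pose small (S T : {set 'I_n}) : bool := [&& S != finset.set0,
  #|T|%:R <= rho * n%:R / 16 :> R & #|T|%:R <= th * #|S|%:R :> R].
pose dense (S T : {set 'I_n}) x : bool :=
  rho * #|S|%:R * D <= \sum_(i in S) \sum_(j in T) graph_mx R x i j.
have n0 : 0 < n%:R :> R by rewrite ltr0n ltnW.
have L0 : 0 <= L by rewrite /L ln_ge0 // ler1n ltnW.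
have D0 := mean_degree_ge0.
apply: (@le_trans _ _ (E (fun x => \sum_(S : {set 'I_n}) \sum_(T | small S T) (dense S T x)%:R))).
  apply: ler_Es => // x; case: asboolP => /= [_|nexp].
    by apply: sumr_ge0 => S _; apply: sumr_ge0.
  have [S [T [ST dST]]] : exists S T, small S T /\ dense S T x.
    apply: contrapT => H; apply: nexp => S T S0 T1 T2.
    rewrite ltNge; apply/negP => dST; apply: H; exists S, T; split => //.
    by apply/and3P.
  rewrite (bigD1 S) //= (bigD1 T) //= dST -addrA lerDl.
  by apply: addr_ge0; [apply: sumr_ge0 | apply: sumr_ge0 => S' _; apply: sumr_ge0].
rewrite /E Es_sum.
pose a := expR (- L).
have aE : a = n%:R^-1 by rewrite /a expRN lnK // posrE.
have an : (1 + a) ^+ n <= 4.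
  have a0 : 0 <= a := expR_ge0 _.
  apply: (@le_trans _ _ (expR a ^+ n)).
    by apply: lerXn2r; rewrite ?nnegrE ?expR_ge0 ?expR_ge1Dx ?addr_ge0.
  rewrite -expRM_natl aE divff ?gt_eqF //.
  have h : expR (1/2) <= 1 + 1/2 + 2 * (1/2) ^+ 2 :> R by exact: expR_le_quad.
  have -> : (1 : R) = 1/2 + 1/2 by field.
  rewrite expRD; have := expR_ge0 (1/2 : R); nra.
(* Each pair contributes at most [exp (- rho D / 16) n^-|S| n^-|T|], and the
   sum of [n^-|S|] over all [S] is [(1 + 1/n)^n]. *)
apply: (@le_trans _ _ (\sum_(S : {set 'I_n}) \sum_(T : {set 'I_n}) expR (- (rho * D / 16)) * (a ^+ #|S| * a ^+ #|T|))).
  apply: ler_sum => S _; rewrite Es_sum big_mkcond; apply: ler_sum => T _.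
  case: ifPn => [/and3P[S0 T1 T2]|_]; last first.
    by rewrite !mulr_ge0 ?exprn_ge0 ?expR_ge0.
  apply: le_trans (prob_dense_pair p01 S n2 r0 T1) _.
  rewrite /a -!expRM_natl -!expRD ler_expR.
  have S1 : 1 <= #|S|%:R :> R by rewrite ler1n card_gt0.
  have h1 : L * #|T|%:R <= #|S|%:R * (rho * D / 32).
    apply: le_trans (ler_wpM2l L0 T2) _.
    by have := ler_wpM2r (ler0n R #|S|) thL; lra.
  have h2 : L * #|S|%:R <= #|S|%:R * (rho * D / 32).
    have : L <= th * L by rewrite ler_peMl.
    by move=> h; have := ler_wpM2r (ler0n R #|S|) (le_trans h thL); lra.
  have h3 : rho * D / 16 <= #|S|%:R * (rho * D / 16).
    by rewrite ler_peMl // divr_ge0 // mulr_ge0.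
  rewrite -/D; lra.
under eq_bigr do rewrite -!mulr_sumr.
rewrite -mulr_sumr -mulr_suml sum_expr_card mulrC; apply: ler_wpM2r; first exact: expR_ge0.
have a1 : 0 <= (1 + a) ^+ n by rewrite exprn_ge0 // addr_ge0 ?expR_ge0.
nra.
Qed.

Lemma mean_indicator_or (B1 B2 : {ffun edge n -> bool} -> bool) (a b : R) :
  E (fun x => (B1 x)%:R) <= a -> E (fun x => (B2 x)%:R) <= b ->
  E (fun x => (B1 x || B2 x)%:R) <= a + b.
Proof.
move=> h1 h2; apply: le_trans (lerD h1 h2); rewrite /E -EsD; apply: ler_Es => // x.
by case: (B1 x); case: (B2 x); rewrite /= ?addr0 ?add0r ?lerDl.
Qed.

Lemma mean_indicator_exists (J : finType) (B : J -> {ffun edge n -> bool} -> bool) (a : R) :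
  (forall j, E (fun x => (B j x)%:R) <= a) ->
  E (fun x => ([exists j, B j x])%:R) <= #|J|%:R * a.
Proof.
move=> h; apply: (@le_trans _ _ (E (fun x => \sum_j (B j x)%:R))).
  apply: ler_Es => // x; case: existsP => [[j Bj]|_]; last by apply: sumr_ge0.
  by rewrite (bigD1 j) //= Bj lerDl; apply: sumr_ge0.
by rewrite /E Es_sum mulr_natl -sumr_const; apply: ler_sum => j _; exact: h.
Qed.

(** With [de = 1 / (16 l)], the Chernoff exponent [de^2 D / 16] is [D / (64 l)^2], and it is the
    weakest of the four. The factor [n + 33] counts [n] degrees, one edge total, and 16 for each
    expansion property. *)
Lemma delocalization_whp (l : nat) (th : R) : (0 < l)%N -> 0 < p ->
  1 <= th -> n%:R <= th ^+ l -> 64 * l%:R * (th * L) <= D -> 64 * (l%:R * L) <= D ->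
  exists2 bad : {ffun edge n -> bool} -> bool,
    E (fun x => (bad x)%:R) <= (n%:R + 33) * expR (- (D / (64 ^+ 2 * l%:R ^+ 2))) &
    forall x (v : 'cV[R]_n), ~~ bad x -> (forall i, 0 <= v i 0) ->
      \sum_i v i 0 ^+ 2 = 1 ->
      (forall i, \sum_j graph_mx R x i j * v j 0 = spectral_norm (graph_mx R x) * v i 0) ->
      \sum_i \sum_j v i 0 ^+ 2 * graph_mx R x i j * v j 0 ^+ 2 <= 1024 * p.
Proof.
move=> l0 p0 th1 thl c1 c2.
have n0 : 0 < n%:R :> R by rewrite ltr0n ltnW.
have n1 : 1 < n%:R :> R by rewrite ltr1n.
have Dp : 0 < D by rewrite mulr_gt0 // subr_gt0.
have Lp : 1 <= l%:R :> R by rewrite ler1n.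
have Lp0 : 0 < l%:R :> R by rewrite ltr0n.
pose de : R := (16 * l%:R)^-1; pose rho : R := (2 * l%:R)^-1.
have de0 : 0 < de by rewrite invr_gt0 mulr_gt0.
have del : de * l%:R = 1/16 by rewrite /de; field; rewrite gt_eqF.
have rhol : rho * l%:R = 1/2 by rewrite /rho; field; rewrite gt_eqF.
have de1 : de <= 1/16 by rewrite -del ler_peMr // ltW.
have rde : rho = 8 * de by rewrite /rho /de; field; rewrite gt_eqF.
have eE : D / (64 ^+ 2 * l%:R ^+ 2) = de ^+ 2 * D / 16 by rewrite /de; field; rewrite gt_eqF.
have de01 : 0 <= de <= 1 by apply/andP; split; lra.
pose bad (x : {ffun edge n -> bool}) := [|| [exists i, (1 + de) * D < \sum_j graph_mx R x i j],
  \sum_i \sum_j graph_mx R x i j < (1 - de) * (n%:R * D),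
  ~~ `[< expanding (graph_mx R x) D rho th >] |
  ~~ `[< expanding (graph_mx R x) D (1/2) l%:R >] ].
exists bad.
  rewrite eE; set q := expR _.
  have b1 i : E (fun x => ((1 + de) * D < \sum_j graph_mx R x i j)%R%:R) <= q.
    exact: prob_high_degree.
  have b2 : E (fun x => (\sum_i \sum_j graph_mx R x i j < (1 - de) * (n%:R * D))%R%:R) <= q.
    apply: le_trans (prob_few_edges _ p01 de01) _; rewrite ler_expR -/D lerN2.
    have : 0 <= de ^+ 2 * D by rewrite mulr_ge0 ?sqr_ge0 // ltW.
    move/(ler_wpM2r); have n1' := ltW n1; move/(_ _ _ n1'); lra.
  have thL : th * L <= rho * D / 32.
    rewrite -(ler_pM2l Lp0).
    have -> : l%:R * (rho * D / 32) = (rho * l%:R) * D / 32 by ring.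
    rewrite rhol; lra.
  have h0 : 0 <= de * D by rewrite mulr_ge0 // ltW.
  have h1 := ler_wpM2r h0 de1.
  have h2 := ler_wpM2r (ltW Dp) de1.
  have q3 : expR (- (rho * D / 16)) <= q.
    rewrite ler_expR lerN2 rde; lra.
  have b3 : E (fun x => (~~ `[< expanding (graph_mx R x) D rho th >])%:R) <= 16 * q.
    apply: le_trans (@prob_not_expanding rho th _ th1 thL) _; first by rewrite rde; lra.
    by apply: ler_wpM2l.
  have q4 : expR (- (1/2 * D / 16)) <= q.
    rewrite ler_expR lerN2; lra.
  have b4 : E (fun x => (~~ `[< expanding (graph_mx R x) D (1/2) l%:R >])%:R) <= 16 * q.
    apply: le_trans (@prob_not_expanding (1/2) l%:R _ Lp _) _; [by [] | lra | ].
    by apply: ler_wpM2l.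
  have := mean_indicator_or (mean_indicator_exists b1) (mean_indicator_or b2 (mean_indicator_or b3 b4)).
  move/le_trans; apply; rewrite card_ord; lra.
move=> x v /norP[/existsPn d1 /norP[d2 /norP[/negPn/asboolP ex1 /negPn/asboolP ex2]]] v0 v1 Av.
rewrite -leNgt in d2.
set A := graph_mx R x in d1 d2 ex1 ex2 Av *.
pose u i := v i 0.
have degA i : \sum_j A i j <= (1 + de) * D by have := d1 i; rewrite -leNgt.
(* Rayleigh quotient of the constant unit vector, that is, the average degree. *)
have lamA : (1 - de) * D <= spectral_norm A.
  have s0 : 0 < Num.sqrt (n%:R : R) by rewrite sqrtr_gt0.
  have s2 : Num.sqrt (n%:R : R) ^+ 2 = n%:R by rewrite sqr_sqrtr // ltW.
  have := @quad_form_le R n A (const_mx (Num.sqrt n%:R)^-1) _.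
  rewrite (eq_bigr (fun=> n%:R^-1)); last by move=> i _; rewrite mxE exprVn s2.
  rewrite sumr_const card_ord -[X in X <= 1]mulr_natr mulVf ?gt_eqF // => /(_ (lexx _)).
  apply: le_trans.
  rewrite (eq_bigr (fun i => n%:R^-1 * \sum_j A i j)); last first.
    move=> i _; rewrite mulr_sumr; apply: eq_bigr => j _.
    have cE k : (const_mx (Num.sqrt n%:R)^-1 : 'cV[R]_n) k 0 = (Num.sqrt n%:R)^-1 by rewrite mxE.
    by rewrite !cE -[in RHS]s2; field; exact: lt0r_neq0.
  rewrite -mulr_sumr ler_pdivlMl //; apply: le_trans d2.
  by rewrite le_eqVlt; apply/orP; left; apply/eqP; ring.
have i1 : 'I_n by exact: (Ordinal n2).
have [i0 _ vM] : exists2 i0 : 'I_n, true & forall j, u j <= u i0.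
  have [i0 _ h] := @arg_maxP _ _ 'I_n i1 xpredT u isT.
  by exists i0 => // j; exact: h.
have A0 := @graph_mx_ge0 R n x.
have M2 := delocalization A0 v0 Av Dp de01 degA lamA l0 (erefl _) th1 thl ex1 ex2 v1 vM.
apply: le_trans (quartic_form_le A0 v0 Av Dp de01 degA vM v1) _.
rewrite -(ler_pM2l n0).
have -> : n%:R * (u i0 ^+ 2 * (2 * D)) = (n%:R * u i0 ^+ 2) * (2 * D) by ring.
apply: (@le_trans _ _ (512 * (2 * D))).
  by apply: ler_wpM2r => //; lra.
by rewrite /D; nra.
Qed.

End RareEvents.

(** * Choice of the parameters *)

Definition range_const (R : realType) : R := (1000 * 1000 * 10)^-1.

(** The upper end of the range of [k] with its denominator cleared. The condition [2 < k] is left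
    out so that [k = 2] can be used for the variance. *)
Definition moment_cond (R : realType) (n : nat) (p k : R) : Prop :=
  ln (8 * (n%:R - 1)) + k * (ln p^-1 + ln (11 ^+ 5 / 4)) <=
  range_const R * (ln (n%:R * p) / ln n%:R) ^+ 2 * (p * (n%:R - 1)).

Lemma ln_ge_half (R : realType) (x : R) : 2 <= x -> 1/2 <= ln x.
Proof.
move=> x2; have xp : 0 < x by lra.
rewrite -ler_expR lnK ?posrE //; apply: le_trans x2.
by have := @expR_le_quad R (1/2) (lexx _); lra.
Qed.

Section Numerics.
Variables (R : realType) (n : nat) (p k : R).
Hypothesis n2 : (2 <= n)%N.
Hypothesis p01 : 0 < p <= 1.
Hypothesis k0 : 0 <= k.
Hypothesis Hk : moment_cond n p k.
Let N : R := n%:R.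
Let L : R := ln N.
Let D : R := p * (N - 1).
Let X : R := ln (N * p).

Let N2 : 2 <= N. Proof. by rewrite /N ler_nat. Qed.

Let L0 : 1/2 <= L. Proof. exact: ln_ge_half. Qed.
Let p0 : 0 < p. Proof. by case/andP: p01. Qed.
Let p1 : p <= 1. Proof. by case/andP: p01. Qed.
Let x0 : 0 < N * p. Proof. by rewrite mulr_gt0 //; have h := N2; lra. Qed.

Lemma ln_const_ge0 : 0 <= ln (11 ^+ 5 / 4) :> R.
Proof.
apply: ln_ge0; rewrite ler_pdivlMr // mul1r.
have : (1 : R) <= 11 ^+ 4 by apply: exprn_ege1; lra.
by rewrite exprS; lra.
Qed.

Lemma lnVp_ge0 : 0 <= ln p^-1.
Proof. by apply: ln_ge0; rewrite invf_ge1. Qed.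

Lemma moment_cond_weak : ln (8 * (N - 1)) + k * ln p^-1 <= range_const R * (X / L) ^+ 2 * D.
Proof.
move: (N2) (L0) (p0) (p1) (x0) => N2' L0' p0' p1' x0'.
apply: le_trans Hk; rewrite lerD2l; apply: ler_wpM2l => //.
by rewrite lerDl ln_const_ge0.
Qed.

(** The range being nonempty forces [n p] to exceed roughly [(ln n)^3]: the left side of
    [moment_cond] is at least [ln (8 (n - 1)) >= L], and [D <= n p = exp X]. *)
Lemma ln_cube_le : L ^+ 3 <= range_const R * X ^+ 2 * expR X.
Proof.
move: (N2) (L0) (p0) (p1) (x0) => N2' L0' p0' p1' x0'.
have c0 : 0 < range_const R by rewrite invr_gt0; lra.
have h : L <= range_const R * (X / L) ^+ 2 * D.
  apply: le_trans moment_cond_weak; rewrite -[leLHS]addr0; apply: lerD.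
    by rewrite /L ler_ln ?posrE; lra.
  by rewrite mulr_ge0 // lnVp_ge0.
have Lp : 0 < L by lra.
have L2 : 0 < L ^+ 2 by rewrite exprn_gt0.
move/(ler_wpM2l (ltW L2)): h; rewrite -exprSr => /le_trans; apply.
have -> : L ^+ 2 * (range_const R * (X / L) ^+ 2 * D) = range_const R * X ^+ 2 * D.
  by field; rewrite gt_eqF.
apply: ler_wpM2l; first by rewrite mulr_ge0 ?sqr_ge0 // ltW.
by rewrite /X lnK ?posrE // /D; lra.
Qed.

Lemma ln_np_ge1 : 1 <= X.
Proof.
move: (N2) (L0) (p0) (p1) (x0) => N2' L0' p0' p1' x0'.
rewrite leNgt; apply/negP => X1.
have c1 : range_const R * 32 < 1.
  by rewrite /range_const mulrC ltr_pdivrMr; lra.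
have c0 : 0 < range_const R by rewrite invr_gt0; lra.
have L3 : 1/8 <= L ^+ 3.
  have -> : (1/8 : R) = (1/2) ^+ 3 by field.
  by apply: lerXn2r; rewrite ?nnegrE; lra.
have : X ^+ 2 * expR X <= 4.
  case: (leP 0 X) => [X0|/ltW X0].
    have e1 : expR X <= 4.
      have h := @expR_le_quad R (X / 2); have -> : X = X / 2 + X / 2 by field.
      rewrite expRD; have /h : X / 2 <= 1/2 by lra.
      have : (X / 2) ^+ 2 <= (1/2) ^+ 2 by apply: lerXn2r; rewrite ?nnegrE; lra.
      by have := expR_ge0 (X / 2); nra.
    have X2 : X ^+ 2 <= 1 by rewrite expr_le1 // ltW.
    have := sqr_ge0 X; have := expR_ge0 X; nra.
  (* For tiny [n p] the square [X^2] is large, but [exp X] wins: [X^2 / 4 <= exp (- X)]. *)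
  have h := expR_ge1Dx (- X / 2).
  have h2 : X ^+ 2 / 4 <= expR (- X).
    have -> : - X = - X / 2 + - X / 2 by field.
    rewrite expRD; have -> : X ^+ 2 / 4 = (- X / 2) * (- X / 2) by field.
    by apply: ler_pM; lra.
  have e0 := expR_ge0 X; have := ler_wpM2r e0 h2.
  rewrite -expRD addNr expR0; lra.
move/(ler_wpM2l (ltW c0)); have := ln_cube_le; lra.
Qed.

Let y : R := expR (X / 8).

Lemma np_root_ge1 : 1 <= y.
Proof.
move: (N2) (L0) (p0) (p1) (x0) => N2' L0' p0' p1' x0'. by rewrite -[leLHS]expR0 ler_expR; have := ln_np_ge1; lra. Qed.

(** The growth factor of the level sets will be [y = (n p)^(1/8)]. With [l <= 9 L] and
    [D >= y^8 / 2], the condition [64 l y L <= D] follows from this bound, as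
    [1152 = 2 * 64 * 9]. *)
Lemma np_root_large : 1152 * L ^+ 2 <= y ^+ 7.
Proof.
move: (N2) (L0) (p0) (p1) (x0) => N2' L0' p0' p1' x0'.
have y1 := np_root_ge1; have X1 := ln_np_ge1.
have c0 : 0 < range_const R by rewrite invr_gt0; lra.
have L3 : L ^+ 3 <= 64 * range_const R * y ^+ 10.
  apply: le_trans ln_cube_le _.
  have -> : expR X = y ^+ 8 by rewrite /y -expRM_natl; congr expR; field.
  have Xy : X ^+ 2 <= (8 * y) ^+ 2.
    by apply: lerXn2r; rewrite ?nnegrE; [lra | lra |]; have := expR_ge1Dx (X / 8); rewrite -/y; lra.
  have h : 0 <= range_const R * y ^+ 8 by rewrite mulr_ge0 ?exprn_ge0 //; lra.
  move/(ler_wpM2l h): Xy => Xy.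
  have -> : range_const R * X ^+ 2 * y ^+ 8 = range_const R * y ^+ 8 * X ^+ 2 by ring.
  apply: le_trans Xy _; rewrite le_eqVlt; apply/orP; left; apply/eqP; ring.
(* Here [t] is 1000. Cubing clears the fractional power: the bound on [L^3] gives [L^6] at most a
   multiple of [y^20], below [y^21]. The numerical needs are [2 t >= 1152] and
   [t >= 8 * 64^2 / 100]. *)
have [t t0 [t1 tE]] : exists2 t : R, 400 <= t & 1152 <= 2 * t /\ range_const R = (t * t * 10)^-1.
  by exists 1000; [lra | split; [lra | ]].
rewrite tE in L3.
have L20 := sqr_ge0 L.
apply: (@le_trans _ _ (2 * t * L ^+ 2)); first exact: ler_wpM2r.
have tp : 0 < t by lra.
have K0 : 0 <= 2 * t by lra.
have L30 : 0 <= L ^+ 3 by apply: exprn_ge0; lra.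
have y0 : 0 <= y by lra.
have h1 : 0 <= 2 * t * L ^+ 2 by exact: mulr_ge0.
have h2 : 0 <= y ^+ 7 by exact: exprn_ge0.
rewrite -(@ler_pXn2r _ 3 isT _ _ h1 h2).
have -> : (2 * t * L ^+ 2) ^+ 3 = (2 * t) ^+ 3 * (L ^+ 3) ^+ 2 by ring.
have h : (L ^+ 3) ^+ 2 <= (64 * (t * t * 10)^-1 * y ^+ 10) ^+ 2.
  by apply: lerXn2r => //; rewrite nnegrE; apply: le_trans L3.
have -> : (y ^+ 7) ^+ 3 = y ^+ 20 * y by ring.
have y20 : 0 <= y ^+ 20 by exact: exprn_ge0.
apply: (@le_trans _ _ (y ^+ 20 * 1)); last exact: ler_wpM2l.
have K3 : 0 <= (2 * t) ^+ 3 by exact: exprn_ge0.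
apply: le_trans (ler_wpM2l K3 h) _.
have -> : (2 * t) ^+ 3 * (64 * (t * t * 10)^-1 * y ^+ 10) ^+ 2 =
  y ^+ 20 * (8 * 64 ^+ 2 / 100 / t) by field; rewrite gt_eqF.
apply: ler_wpM2l => //.
rewrite ler_pdivrMr //; lra.
Qed.

Lemma parameter_choice : exists l : nat, exists th : R,
  [/\ (0 < l)%N, 1 <= th, n%:R <= th ^+ l, 64 * l%:R * (th * L) <= D & 64 * (l%:R * L) <= D] /\
  (n%:R + 33) * expR (- (D / (64 ^+ 2 * l%:R ^+ 2))) <= p `^ k.
Proof.
move: (N2) (L0) (p0) (p1) (x0) => N2' L0' p0' p1' x0'.
have X1 := ln_np_ge1; have y1 := np_root_ge1.
have Lp : 0 < L by lra.
(* [y^q = n] exactly; rounding [q] up costs at most one step, so [l X <= 8 L + X <= 9 L]. *)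
pose q := L * 8 / X; have q0 : 0 <= q by rewrite /q divr_ge0 ?mulr_ge0 //; lra.
have XL : X <= L by rewrite /X /L ler_ln ?posrE //; [rewrite -[leRHS]mulr1 ler_wpM2l //|]; lra.
pose l := (Num.truncn q).+1.
have lq : q < l%:R by rewrite /l truncnS_gt.
have lq' : l%:R <= q + 1 by rewrite /l -natr1 lerD2r truncn_le.
have l9 : l%:R * X <= 9 * L.
  have Xp : 0 <= X by lra.
  apply: le_trans (ler_wpM2r Xp lq') _.
  have -> : (q + 1) * X = 8 * L + X by rewrite /q; field; rewrite gt_eqF //; lra.
  lra.
have lp : 0 < l%:R :> R by rewrite ltr0n.
have l9L : l%:R <= 9 * L by apply: le_trans l9; rewrite ler_peMr // ltW.
have Dy : y ^+ 8 / 2 <= D.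
  have -> : y ^+ 8 = N * p by rewrite -[RHS]lnK ?posrE // /y -expRM_natl; congr expR; rewrite -/X; field.
  rewrite /D; nra.
have main : 64 * l%:R * (y * L) <= D.
  apply: le_trans Dy.
  have yL : 0 <= 64 * (y * L) by rewrite !mulr_ge0 //; lra.
  have := ler_wpM2r yL l9L.
  have yp : 0 <= y / 2 by lra.
  have := ler_wpM2r yp np_root_large.
  have -> : y ^+ 7 * (y / 2) = y ^+ 8 / 2 by ring.
  lra.
exists l, y; split; first split => //.
- rewrite /y -expRM_natl; rewrite -[leLHS]lnK ?posrE; last by rewrite -/N; lra.
  rewrite ler_expR -/N -/L; have : q * (X / 8) <= l%:R * (X / 8) by apply: ler_wpM2r; lra.
  have -> : q * (X / 8) = L; last by [].
  by rewrite /q; field; rewrite gt_eqF //; lra.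
- apply: le_trans main; rewrite -mulrA; apply: ler_wpM2l => //; apply: ler_wpM2l; first exact: ltW.
  by rewrite ler_peMl // ltW.
have H := moment_cond_weak; set W := range_const R * _ * _ in H.
have N1 : 0 < 8 * (N - 1) by lra.
have Dp : 0 < D by rewrite /D mulr_gt0 //; lra.
(* Since [l X / L <= 9], this amounts to [2 * 64^2 * 9^2 * range_const <= 1]. The factor 2 on the
   left yields [(8 (n - 1))^2] in the denominator, which beats the prefactor [n + 33]. *)
have W2 : 2 * W <= D / (64 ^+ 2 * l%:R ^+ 2).
  rewrite ler_pdivlMr; last by rewrite mulr_gt0 // exprn_gt0.
  have -> : 2 * W * (64 ^+ 2 * l%:R ^+ 2) = D * (2 * 64 ^+ 2 * range_const R) * ((l%:R * X) / L) ^+ 2.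
    by rewrite /W; field; rewrite gt_eqF.
  have : ((l%:R * X) / L) ^+ 2 <= 9 ^+ 2.
    apply: lerXn2r; rewrite ?nnegrE //; first by rewrite divr_ge0 ?mulr_ge0 //; lra.
    by rewrite ler_pdivrMr.
  have c0 : 0 <= range_const R by rewrite invr_ge0; lra.
  have A0 : 0 <= D * (2 * 64 ^+ 2 * range_const R).
    by apply: mulr_ge0; [exact: ltW | apply: mulr_ge0; [lra | exact: c0]].
  move/(ler_wpM2l A0)/le_trans; apply.
  have [t t0 tE] : exists2 t : R, 400 <= t & range_const R = (t * t * 10)^-1.
    by exists 1000; [lra | ].
  have tp : 0 < t by lra.
  rewrite tE -[leRHS]mulr1 -[leLHS]mulrA; apply: ler_wpM2l; first exact: ltW.
  have -> : 2 * 64 ^+ 2 * (t * t * 10)^-1 * 9 ^+ 2 = 2 * (64 * 9) ^+ 2 / 10 / (t * t).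
    by field; rewrite gt_eqF.
  rewrite ler_pdivrMr ?mulr_gt0 // mul1r.
  have : 400 * 400 <= t * t by apply: ler_pM; lra.
  lra.
apply: (@le_trans _ _ ((N + 33) * expR (- (2 * ln (8 * (N - 1)) + k * ln p^-1)))).
  apply: ler_wpM2l; first by lra.
  rewrite ler_expR lerN2.
  have h1 : 0 <= k * ln p^-1 by rewrite mulr_ge0 // lnVp_ge0.
  lra.
rewrite opprD expRD lnV ?posrE // mulrN opprK.
have -> : p `^ k = expR (k * ln p) by rewrite /powR gt_eqF.
rewrite mulrA -[leRHS]mul1r; apply: ler_wpM2r; first exact: expR_ge0.
have -> : - (2 * ln (8 * (N - 1))) = ln ((8 * (N - 1)) ^-2).
  by rewrite lnV ?posrE ?exprn_gt0 // lnXn // mulr_natl.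
rewrite lnK ?posrE ?invr_gt0 ?exprn_gt0 // ler_pdivrMr ?exprn_gt0 // mul1r.
nra.
Qed.

End Numerics.

(** * Moments *)

Lemma powR_expR_ln (R : realType) (a b : R) : 0 < a -> a `^ b = expR (b * ln a).
Proof. by move=> a0; rewrite /powR gt_eqF. Qed.

(** This is [ln u <= u - 1] at [u = la t / k], multiplied by [k]. *)
Lemma powR_le_expR (R : realType) (la k t : R) : 0 < la -> 0 < k ->
  Num.max t 0 `^ k <= (k / la) `^ k * expR (la * t - k).
Proof.
move=> l0 k0; case: (leP t 0) => [t0|t0].
  by rewrite powR0 ?gt_eqF // mulr_ge0 ?powR_ge0 ?expR_ge0.
have kl : 0 < k / la by rewrite divr_gt0.
have u0 : 0 < la * t / k by rewrite divr_gt0 ?mulr_gt0.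
have -> : t = (k / la) * (la * t / k) by field; rewrite !gt_eqF.
rewrite [leLHS]powRM; [|exact: ltW|exact: ltW].
apply: ler_wpM2l; first exact: powR_ge0.
rewrite powR_expR_ln // ler_expR.
have -> : la * (k / la * (la * t / k)) - k = k * (la * t / k - 1) by field; rewrite !gt_eqF.
apply: ler_wpM2l; first exact: ltW.
rewrite -ler_expR lnK ?posrE //; have := expR_ge1Dx (la * t / k - 1); lra.
Qed.

Section SubGaussianMoments.
Variables (R : realType) (p : R) (I : finType) (s : seq I) (x0 : {ffun I -> bool}).
Variables (Z : {ffun I -> bool} -> R) (al : {ffun I -> bool} -> I -> R).
Hypothesis p01 : 0 <= p <= 1.
Hypothesis us : uniq s.
Hypothesis sI : forall i, i \in s.
Hypothesis grad : forall x y, Z x - Z y <= \sum_(i <- s) al x i * (x i != y i)%:R.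
Let E f := Es p s f x0.
Let m := E Z.
Let V x := \sum_(i <- s) al x i ^+ 2.

(** Transport for [la Z] bounds the product of the two means by 1, and Jensen bounds each factor
    from below: the second mean is at least 1 because [Z - m] is centred, the first at least
    [exp (- 4 la^2 E V)]. Dividing gives both claims. *)
Lemma upper_lower_mgf (la : R) : 0 <= la ->
  E (fun x => expR (la * (Z x - m) - 4 * la ^+ 2 * V x)) <= 1 /\
  E (fun x => expR (- la * (Z x - m))) <= expR (4 * la ^+ 2 * E V).
Proof.
move=> l0; set B := E (fun x => expR (la * _ - _)); set A := E _.
have AB : B * A <= 1.
  have := @Es_transport R p I p01 s (fun x => la * Z x) (fun x i => la * al x i) x0 us sI _.
  have -> : B = expR (- (la * m)) * Es p s (fun y => expR (la * Z y -
      4 * \sum_(i <- s) (la * al y i) ^+ 2)) x0.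
    rewrite -EsZ; apply: eq_Es => y; rewrite -expRD; congr expR.
    have -> : \sum_(i <- s) (la * al y i) ^+ 2 = la ^+ 2 * V y.
      by rewrite mulr_sumr; apply: eq_bigr => i _; rewrite exprMn.
    by ring.
  have -> : A = expR (la * m) * Es p s (fun y => expR (- (la * Z y))) x0.
    by rewrite -EsZ; apply: eq_Es => y; rewrite -expRD; congr expR; ring.
  set a := Es _ _ _ _; set b := Es _ _ _ _ => H.
  have -> : expR (- (la * m)) * a * (expR (la * m) * b) = (expR (- (la * m)) * expR (la * m)) * (a * b) by ring.
  rewrite -expRD addNr expR0 mul1r; apply: H => x y.
  rewrite -mulrBr; apply: le_trans (ler_wpM2l l0 (grad x y)) _.
  by rewrite mulr_sumr le_eqVlt; apply/orP; left; apply/eqP; apply: eq_bigr => i _; rewrite mulrA.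
have B0 : 0 < B by apply: Es_gt0 => // x; exact: expR_gt0.
have A1 : 1 <= A.
  apply: (@le_trans _ _ (E (fun x => (1 + la * m) + - la * Z x))).
    by rewrite /m /E EsD EsC EsZ; lra.
  by apply: ler_Es => // x; apply: le_trans (expR_ge1Dx _); lra.
split; first by apply: le_trans AB; rewrite ler_peMr // ltW.
(* Jensen through the tangent line of [exp] at [w], the mean of the exponent. *)
pose w := - (4 * la ^+ 2 * E V).
have Bw : expR w <= B.
  apply: (@le_trans _ _ (E (fun x => expR w * (1 - w - la * m) + expR w * (la * Z x + - (4 * la ^+ 2) * V x)))).
    rewrite /w /m /E EsD EsC EsZ EsD !EsZ le_eqVlt; apply/orP; left; apply/eqP; ring.
  apply: ler_Es => // x; rewrite -mulrDr.
  have -> : la * (Z x - m) - 4 * la ^+ 2 * V x = w + (la * (Z x - m) - 4 * la ^+ 2 * V x - w) by ring.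
  rewrite expRD; apply: ler_wpM2l; first exact: expR_ge0.
  by apply: le_trans (expR_ge1Dx _); lra.
have Ap : 0 <= A by lra.
have := ler_wpM2r Ap Bw => H; have := le_trans H AB.
have -> : 4 * la ^+ 2 * E V = - w by rewrite /w opprK.
rewrite expRN => H2; rewrite -[leRHS]mulr1 -ler_pdivrMl ?invr_gt0 ?expR_gt0 //.
by rewrite invrK.
Qed.

Lemma lower_moment_le (v k : R) : 0 < v -> 0 < k -> E V <= v ->
  E (fun x => Num.max (- (Z x - m)) 0 `^ k) <= (4 * k * v) `^ (k / 2).
Proof.
(* This [la] gives [4 la^2 v = k], which cancels the [exp (- k)] of [powR_le_expR]. *)
move=> v0 k0 EV; pose la := Num.sqrt (k / (4 * v)).
have l0 : 0 < la by rewrite sqrtr_gt0 divr_gt0 // mulr_gt0.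
have l2 : la ^+ 2 = k / (4 * v) by rewrite sqr_sqrtr // ltW // divr_gt0 // mulr_gt0.
have [_ H] := upper_lower_mgf (ltW l0).
have klE : (k / la) `^ k = (4 * k * v) `^ (k / 2).
  have kl : 0 < k / la by rewrite divr_gt0.
  have -> : 4 * k * v = (k / la) ^+ 2 by rewrite expr_div_n l2; field; rewrite !gt_eqF.
  rewrite !powR_expR_ln ?exprn_gt0 // lnXn //; congr expR.
  by rewrite -mulr_natl; field.
apply: (@le_trans _ _ (E (fun x => (k / la) `^ k * expR (- k) * expR (- la * (Z x - m))))).
  apply: ler_Es => // x; apply: le_trans (powR_le_expR _ l0 k0) _.
  rewrite -mulrA -expRD; apply: ler_wpM2l; first exact: powR_ge0.
  by rewrite ler_expR; lra.
rewrite /E EsZ -klE -mulrA -[leRHS]mulr1; apply: ler_wpM2l; first exact: powR_ge0.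
apply: le_trans (ler_wpM2l (expR_ge0 _) H) _.
rewrite -expRD -[leRHS]expR0 ler_expR.
have : 4 * la ^+ 2 * E V <= 4 * la ^+ 2 * v by apply: ler_wpM2l => //; rewrite mulr_ge0 ?sqr_ge0.
have -> : 4 * la ^+ 2 * v = k by rewrite l2; field; rewrite gt_eqF.
lra.
Qed.

(** The lower tail sees only [E V], but here [V] is inside the exponential and must be bounded
    pointwise: by [c p] off the bad event, by 2 on it. The multipliers satisfy [4 la^2 c p = k] and
    [4 mu^2 * 2 = 2 k], matching the exponents [k] and [2 k]. *)
Lemma upper_moment_le (bad : {ffun I -> bool} -> bool) (c k : R) :
  0 < p -> 4 <= c -> 1 <= k -> (forall x, ~~ bad x -> V x <= c * p) -> (forall x, V x <= 2) ->
  E (fun x => (bad x)%:R) <= p `^ k ->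
  E (fun x => Num.max (Z x - m) 0 `^ k) <= (16 * c * k * p) `^ (k / 2).
Proof.
move=> p0 c4 k1 good V2 Pbad.
have k0 : 0 < k by lra.
have c0 : 0 < c by lra.
pose W := 4 * c * k * p.
have W0 : 0 < W by rewrite !mulr_gt0.
(* AM-GM on the bad event: [2 t^k 1_bad <= q t^2k + 1_bad / q]. *)
pose q := (p / (16 * k)) `^ (k / 2).
have q0 : 0 < q by rewrite powR_gt0 // divr_gt0 // mulr_gt0.
pose la := Num.sqrt (k / (4 * (c * p))).
have v0 : 0 < c * p by rewrite mulr_gt0.
have l0 : 0 < la by rewrite sqrtr_gt0 divr_gt0 // mulr_gt0.
have l2 : la ^+ 2 = k / (4 * (c * p)) by rewrite sqr_sqrtr // ltW // divr_gt0 // mulr_gt0.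
pose mu := Num.sqrt (k / 4).
have mu0 : 0 < mu by rewrite sqrtr_gt0 divr_gt0.
have mu2 : mu ^+ 2 = k / 4 by rewrite sqr_sqrtr // ltW // divr_gt0.
have [H1 _] := upper_lower_mgf (ltW l0).
have [H2 _] := upper_lower_mgf (ltW mu0).
have klE : (k / la) `^ k = W `^ (k / 2).
  have kl : 0 < k / la by rewrite divr_gt0.
  have -> : W = (k / la) ^+ 2 by rewrite /W expr_div_n l2; field; rewrite !gt_eqF.
  rewrite !powR_expR_ln ?exprn_gt0 // lnXn //; congr expR.
  by rewrite -mulr_natl; field.
have kmE : (2 * k / mu) `^ (2 * k) = (16 * k) `^ k.
  have kl : 0 < 2 * k / mu by rewrite divr_gt0 // mulr_gt0.
  have -> : 16 * k = (2 * k / mu) ^+ 2 by rewrite expr_div_n mu2; field; rewrite !gt_eqF.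
  rewrite !powR_expR_ln ?exprn_gt0 // lnXn //; congr expR.
  by rewrite -mulr_natl; field.
have point x : Num.max (Z x - m) 0 `^ k <=
    W `^ (k / 2) * expR (la * (Z x - m) - 4 * la ^+ 2 * V x) +
    ((16 * k) `^ k * q / 2 * expR (mu * (Z x - m) - 4 * mu ^+ 2 * V x) + (2 * q)^-1 * (bad x)%:R).
  set t := Num.max _ _.
  case: (boolP (bad x)) => [_|/good Vx].
    apply: ler_wpDl; first by rewrite mulr_ge0 ?powR_ge0 ?expR_ge0.
    have T : t `^ (2 * k) <= (16 * k) `^ k * expR (mu * (Z x - m) - 4 * mu ^+ 2 * V x).
      have k20 : 0 < 2 * k by lra.
      apply: le_trans (powR_le_expR _ mu0 k20) _; rewrite kmE.
      apply: ler_wpM2l; first exact: powR_ge0.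
      rewrite ler_expR mu2; have := ler_wpM2l (ltW k0) (V2 x); lra.
    have Tt : t `^ (2 * k) = (t `^ k) ^+ 2 by rewrite mulrC powRrM powR_mulrn ?powR_ge0.
    rewrite Tt in T; have := ler_wpM2l (ltW q0) T.
    move: (sqr_ge0 (q * t `^ k - 1)); set u := t `^ k; set G := expR _; set F := (16 * k) `^ k => h1 h2.
    rewrite mulr1 -(ler_pM2l q0).
    have -> : q * (F * q / 2 * G + (2 * q)^-1) = (q * (q * (F * G)) + 1) / 2 by field; rewrite gt_eqF.
    have := ler_wpM2l (ltW q0) h2; nra.
  apply: ler_wpDr.
    by rewrite addr_ge0 // mulr_ge0 ?invr_ge0 ?mulr_ge0 ?powR_ge0 ?expR_ge0 // ltW.
  apply: le_trans (powR_le_expR _ l0 k0) _; rewrite klE; apply: ler_wpM2l; first exact: powR_ge0.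
  rewrite ler_expR lerD2l lerN2.
  have -> : k = 4 * la ^+ 2 * (c * p) by rewrite l2; field; rewrite !gt_eqF.
  by apply: ler_wpM2l => //; rewrite mulr_ge0 ?sqr_ge0.
have tot : E (fun x => Num.max (Z x - m) 0 `^ k) <=
    W `^ (k / 2) + ((16 * k) `^ k * q / 2 + (2 * q)^-1 * p `^ k).
  apply: le_trans (ler_Es p01 s x0 point) _.
  rewrite EsD EsZ EsD !EsZ; apply: lerD.
    by rewrite -[leRHS]mulr1; apply: ler_wpM2l; first exact: powR_ge0.
  apply: lerD; last by apply: ler_wpM2l => //; rewrite invr_ge0 mulr_ge0 // ltW.
  by rewrite -[leRHS]mulr1; apply: ler_wpM2l => //; rewrite mulr_ge0 ?mulr_ge0 ?powR_ge0.
apply: le_trans tot _.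
have k160 : 0 < 16 * k by rewrite mulr_gt0.
pose U := (16 * k * p) `^ (k / 2).
(* The choice of [q] balances the two halves of the AM-GM bound: both [(16 k)^k q] and [p^k / q]
   equal [U]. This is where the probability [p^k] of the bad event is required. *)
have e1 : (16 * k) `^ k * q = U.
  rewrite /q /U; move: (16 * k) k160 => b b0; rewrite !powR_expR_ln ?mulr_gt0 ?divr_gt0 ?invr_gt0 // -expRD; congr expR.
  by rewrite !lnM ?lnV ?posrE ?mulr_gt0 ?invr_gt0 //; field.
have e2 : p `^ k = q * U.
  rewrite /q /U; move: (16 * k) k160 => b b0; rewrite !powR_expR_ln ?mulr_gt0 ?divr_gt0 ?invr_gt0 // -expRD; congr expR.
  by rewrite !lnM ?lnV ?posrE ?mulr_gt0 ?invr_gt0 //; field.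
have -> : (16 * k) `^ k * q / 2 + (2 * q)^-1 * p `^ k = U.
  by rewrite e1 e2; field; rewrite gt_eqF.
have UW : U <= W `^ (k / 2).
  apply: ge0_ler_powR; rewrite ?nnegrE; [lra | by rewrite ltW // !mulr_gt0 | exact: ltW | ].
  rewrite /W; have := ler_wpM2r (ltW (mulr_gt0 k0 p0)) c4; lra.
have -> : 16 * c * k * p = 4 * W by rewrite /W; ring.
rewrite powRM ?(ltW W0) //.
(* The two contributions add up to at most [2 W^(k/2)]; the 2 is absorbed into the base. *)
have four : 2 <= 4 `^ (k / 2) :> R.
  apply: (@le_trans _ _ (4 `^ (1 / 2))).
    rewrite div1r powR12_sqrt //; have -> : (4 : R) = 2 ^+ 2 by ring.
    by rewrite sqrtr_sqr ger0_norm.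
  by apply: ler_powR; lra.
have := ler_wpM2r (powR_ge0 W (k / 2)) four; lra.
Qed.

End SubGaussianMoments.

(** Bounds [E V / p]: twice 1024 from the good event, and 2 from the bad one, where [V <= 2] and the
    probability is at most [p^k <= p]. *)
Definition var_const (R : realType) : R := 2050.

Lemma var_constE (R : realType) : exists2 K : R, K = var_const R & 2 * 1024 + 2 <= K.
Proof. by exists (var_const R) => //; rewrite /var_const; lra. Qed.

Section GraphMoments.
Variables (R : realType) (n : nat) (p k : R).
Hypothesis n2 : (2 <= n)%N.
Hypothesis p01 : 0 < p <= 1.
Hypothesis k1 : 1 <= k.
Hypothesis Hk : moment_cond n p k.
Let E (f : {ffun edge n -> bool} -> R) := Es p (enum (edge n)) f [ffun=> false].
Let Z (x : {ffun edge n -> bool}) : R := spectral_norm (graph_mx R x).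

Let perron_choice : exists v : {ffun edge n -> bool} -> 'I_n -> R, forall x,
  [/\ forall i, 0 <= v x i, \sum_i v x i ^+ 2 = 1 &
    forall i, \sum_j graph_mx R x i j * v x j = Z x * v x i].
Proof.
have H : forall x, exists u : 'I_n -> R, [/\ forall i, 0 <= u i, \sum_i u i ^+ 2 = 1 &
    forall i, \sum_j graph_mx R x i j * u j = Z x * u i].
  move=> x; rewrite /Z; case: n n2 x => // n' _ x.
  have [v [v0 v1 Av]] := perron_vector (@graph_mx_ge0 R _ x) (@graph_mx_sym R _ x).
  by exists (fun i => v i 0).
by have [v Hv] := choice H; exists v.
Qed.

Lemma graph_moments (m := E Z) :
  E (fun x => Num.max (Z x - m) 0 `^ k) <= (16 * var_const R * k * p) `^ (k / 2) /\
  E (fun x => Num.max (- (Z x - m)) 0 `^ k) <= (16 * var_const R * k * p) `^ (k / 2).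
Proof.
have [K <- K1] := var_constE R.
have [p0 p1] : 0 < p /\ p <= 1 by case/andP: p01.
have k1' := k1; have k0 : 0 <= k by lra.
have kp : 0 < k by lra.
have [v Hv] := perron_choice.
have v0 x i : 0 <= v x i by have [] := Hv x.
have v1 x : \sum_i v x i ^+ 2 = 1 by have [] := Hv x.
have Av x i : \sum_j graph_mx R x i j * v x j = Z x * v x i by have [] := Hv x.
have ple : 0 <= p <= 1 by rewrite ltW.
have us := enum_uniq (edge n).
have sI (e : edge n) : e \in enum (edge n) by rewrite mem_enum.
(* The factor [x e] is legitimate because an edge present only in [y] can but lower [Z x - Z y], the
   Perron vector of [x] being nonnegative. *)
pose al x (e : edge n) : R := 2 * v x (val e).1 * v x (val e).2 * (x e)%:R.
have formE x y : \sum_i \sum_j v x i * graph_mx R y i j * v x j =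
    \sum_(e : edge n) 2 * v x (val e).1 * v x (val e).2 * (y e)%:R.
  under eq_bigr do under eq_bigr do rewrite mulrAC.
  by rewrite sum_graph_mx; apply: eq_bigr => e _; ring.
have grad x y : Z x - Z y <= \sum_(e <- enum (edge n)) al x e * (x e != y e)%:R.
  have -> : Z x = \sum_i \sum_j v x i * graph_mx R x i j * v x j.
    rewrite -[LHS]mulr1 -(v1 x) mulr_sumr; apply: eq_bigr => i _.
    by rewrite expr2 mulrA -Av mulr_suml; apply: eq_bigr => j _; ring.
  have : \sum_i \sum_j v x i * graph_mx R y i j * v x j <= Z y.
    have H := @quad_form_le R n (graph_mx R y) (\col_i v x i).
    have e1 : \sum_i (\col_i v x i : 'cV[R]_n) i 0 ^+ 2 = 1.
      by rewrite -(v1 x); apply: eq_bigr => i _; rewrite mxE.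
    rewrite e1 lexx in H; apply: le_trans (H isT).
    rewrite le_eqVlt; apply/orP; left; apply/eqP.
    by apply: eq_bigr => i _; apply: eq_bigr => j _; rewrite [in RHS]mxE [X in _ = _ * X]mxE.
  rewrite !formE big_enum => h; apply: (@le_trans _ _ (\sum_(e : edge n) 2 * v x (val e).1 * v x (val e).2 * (x e)%:R -
     \sum_(e : edge n) 2 * v x (val e).1 * v x (val e).2 * (y e)%:R)); first by lra.
  rewrite -sumrB; apply: ler_sum => e _; rewrite /al.
  have g0 : 0 <= 2 * v x (val e).1 * v x (val e).2 by rewrite !mulr_ge0.
  by case: (x e); case: (y e); rewrite /= ?mulr1 ?mulr0 ?subr0 ?subrr // sub0r oppr_le0.
pose V x := \sum_(e <- enum (edge n)) al x e ^+ 2.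
have VE x : V x = 2 * \sum_i \sum_j v x i ^+ 2 * graph_mx R x i j * v x j ^+ 2.
  under eq_bigr do under eq_bigr do rewrite mulrAC.
  rewrite sum_graph_mx /V big_enum mulr_sumr; apply: eq_bigr => e _; rewrite /al.
  by case: (x e); rewrite /= ?mulr1 ?mulr0 ?expr0n //; ring.
have V2 x : V x <= 2.
  rewrite VE -[leRHS]mulr1; apply: ler_wpM2l => //.
  have -> : (1 : R) = \sum_i \sum_j v x i ^+ 2 * v x j ^+ 2.
    under [RHS]eq_bigr do rewrite -mulr_sumr v1 mulr1.
    by rewrite v1.
  apply: ler_sum => i _; apply: ler_sum => j _.
  have a1 := graph_mx_le1 R x i j.
  by apply: ler_wpM2r; [exact: sqr_ge0 | rewrite ler_piMr ?sqr_ge0].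
have [l [th [[l0 th1 thl c1 c2] Hp]]] := parameter_choice n2 p01 k0 Hk.
have [bad Pbad good] := delocalization_whp n2 ple l0 p0 th1 thl c1 c2.
have {}Pbad : E (fun x => (bad x)%:R) <= p `^ k := le_trans Pbad Hp.
have {}good x : ~~ bad x -> V x <= (K - 2) * p.
  move=> bx; have cE i : (\col_i v x i : 'cV[R]_n) i 0 = v x i by rewrite mxE.
  have := good x (\col_i v x i) bx.
  have -> : \sum_i \sum_j (\col_i v x i : 'cV[R]_n) i 0 ^+ 2 * graph_mx R x i j * (\col_i v x i : 'cV[R]_n) j 0 ^+ 2 =
      \sum_i \sum_j v x i ^+ 2 * graph_mx R x i j * v x j ^+ 2.
    by apply: eq_bigr => i _; apply: eq_bigr => j _; rewrite !cE.
  have u1 : \sum_i (\col_i v x i : 'cV[R]_n) i 0 ^+ 2 = 1.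
    by rewrite -(v1 x); apply: eq_bigr => i _; rewrite cE.
  have u0 i : 0 <= (\col_i v x i : 'cV[R]_n) i 0 by rewrite cE.
  have Au i : \sum_j graph_mx R x i j * (\col_i v x i : 'cV[R]_n) j 0 =
      spectral_norm (graph_mx R x) * (\col_i v x i : 'cV[R]_n) i 0.
    by rewrite cE -/(Z x) -Av; apply: eq_bigr => j _; rewrite cE.
  move=> /(_ u0 u1 Au); rewrite VE => h; have := ler_wpM2r (ltW p0) K1; lra.
have pk : p `^ k <= p.
  rewrite -[leRHS]lnK ?posrE // powR_expR_ln // ler_expR.
  have : ln p <= 0 by exact: ln_le0.
  by move=> h; have := ler_wnM2r h k1'; rewrite mul1r.
have EV : E V <= K * p.
  apply: (@le_trans _ _ (E (fun x => (K - 2) * p + 2 * (bad x)%:R))).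
    apply: ler_Es => // x; case: (boolP (bad x)) => [_|/good h].
      have K2 : 0 <= (K - 2) * p by rewrite mulr_ge0 //; [lra | exact: ltW].
      by have := V2 x; rewrite /=; lra.
    by rewrite mulr0 addr0.
  by rewrite /E EsD EsC EsZ; rewrite /E in Pbad; lra.
have kpp := mulr_gt0 kp p0.
split.
  apply: (@upper_moment_le R p (edge n) _ _ Z al ple us sI grad bad) => //; first by lra.
  by move=> x /good h; apply: le_trans h _; rewrite ler_pM2r //; lra.
have v2 : 0 < K * p by rewrite mulr_gt0 //; lra.
apply: le_trans (lower_moment_le ple us sI grad v2 kp EV) _.
have Kp : 0 <= K * (k * p) by rewrite mulr_ge0 //; [lra | exact: ltW].
apply: ge0_ler_powR; rewrite ?nnegrE; lra.
Qed.

End GraphMoments.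

(** * Back to the uniform variables *)

Lemma uniform_prob_below (R : realType) (p : R) : 0 <= p <= 1 ->
  uniform_prob (@ltr01 R) `]-oo, p[%classic = p%:E.
Proof.
move=> /andP[p0 p1]; rewrite /uniform_prob integral_uniform_pdf.
have -> : `]-oo, p[%classic `&` `[0, 1]%classic = `[0, p[%classic :> set R.
  apply/seteqP; split => x /=; rewrite !in_itv /=.
    by case=> xp /andP[x0 _]; rewrite x0.
  by case/andP=> x0 xp; split => //; rewrite x0 /= ltW // (lt_le_trans xp).
rewrite (eq_integral (cst 1%E)).
  rewrite integral_cst //= mul1e lebesgue_measure_itv /= lte_fin.
  case: ltP => h; first by rewrite sube0.
  by congr EFin; apply/eqP; rewrite eq_le p0 h.
move=> x; rewrite inE /= in_itv /= => /andP[x0 xp].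
by rewrite /uniform_pdf x0 ltW ?(lt_le_trans xp) //= subr0 invr1.
Qed.

Lemma expectation_sum_indic d (T : measurableType d) (R : realType) (P : probability T R)
    (J : Type) (s : seq J) (c : J -> R) (A : J -> set T) :
  (forall j, measurable (A j)) ->
  P.-integrable setT (EFin \o (fun w => \sum_(j <- s) c j * \1_(A j) w)) /\
  'E_P[(fun w => \sum_(j <- s) c j * \1_(A j) w)%R]%E = (\sum_(j <- s) c j * fine (P (A j)))%:E.
Proof.
move=> mA; elim: s => [|j s [IHi IHe]].
  have -> : (fun w => \sum_(j <- [::]) c j * \1_(A j) w) = cst 0 :> (T -> R).
    by apply/funext => w; rewrite big_nil.
  rewrite expectation_cst big_nil; split => //.
  by apply: finite_measure_integrable_cst.
have -> : (fun w => \sum_(i <- j :: s) c i * \1_(A i) w) =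
   (fun w => c j * \1_(A j) w + \sum_(i <- s) c i * \1_(A i) w) :> (T -> R).
  by apply/funext => w; rewrite big_cons.
have i1 : P.-integrable setT (EFin \o \1_(A j)).
  exact: integrable_indic.
have i2 : P.-integrable setT (EFin \o (fun w => c j * \1_(A j) w)).
  exact: (integrableZl measurableT (c j) i1).
split.
  exact: (integrableD measurableT i2 IHi).
rewrite big_cons EFinD -IHe unlock.
under eq_integral do rewrite EFinD.
rewrite integralD_EFin //; congr (_ + _)%E.
rewrite /=; under eq_integral do rewrite EFinM.
rewrite integralZl // integral_indic // setIT EFinM fineK //.
exact: fin_num_measure.
Qed.

Section Transfer.
Variables (d : measure_display) (T : measurableType d) (R : realType) (P : probability T R).
Variables (n : nat) (U : 'I_n -> 'I_n -> {RV P >-> R}) (p : R).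
Hypothesis HU : iid_uniform U.
Hypothesis p01 : 0 <= p <= 1.

Definition sample_bits (w : T) : {ffun edge n -> bool} :=
  [ffun e : edge n => U (val e).1 (val e).2 w < p].

Lemma adjacencyE w : adjacency U p w = graph_mx R (sample_bits w).
Proof.
apply/matrixP => i j; rewrite !mxE /edge_bit.
case: (ltnP i j) => [ij|ji].
  by rewrite insubT [insub (j, i)]insubF /= ?ltnNge ?(ltnW ij) // ffunE addr0.
case: ifPn => [ji'|ij].
  by rewrite insubF /= ?ltnNge ?ji // insubT ffunE add0r.
by rewrite insubF /= ?ltnNge ?ji // insubF ?(negbTE ij) ?addr0.
Qed.

Let half (b : bool) : set R := if b then `]-oo, p[%classic else ~` `]-oo, p[%classic.

Let mhalf b : measurable (half b).
Proof. by case: b; [|apply: measurableC]; exact: measurable_itv. Qed.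

Lemma prob_half (e : edge n) b :
  P (U (val e).1 (val e).2 @^-1` half b) = (if b then p else 1 - p)%:E.
Proof.
have [_ HU2] := HU; have := HU2 _ _ (valP e) _ (mhalf b).
rewrite /distribution /pushforward => ->; case: b; rewrite /half.
  exact: uniform_prob_below.
rewrite probability_setC // [X in (_ - X)%E](_ : _ = p%:E) //; exact: uniform_prob_below.
Qed.

Lemma sample_bits_preimage (x : {ffun edge n -> bool}) :
  sample_bits @^-1` [set x] =
  \bigcap_(e in [set e : edge n | e \in [set: edge n]%SET]) (U (val e).1 (val e).2 @^-1` half (x e)).
Proof.
apply/seteqP; split => w /=.
  move=> <- e _; rewrite /= ffunE /half; case: ifPn => h.
    by rewrite /= in_itv.
  by rewrite /= in_itv /=; apply/negP.
move=> H; apply/ffunP => e; rewrite ffunE.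
have := H e (finset.in_setT e); rewrite /half; case: (x e); rewrite /= in_itv //=.
by move/negP/negbTE.
Qed.

Lemma measurable_sample_bits (x : {ffun edge n -> bool}) :
  measurable (sample_bits @^-1` [set x]).
Proof.
rewrite sample_bits_preimage; apply: fin_bigcap_measurable => [|e _].
  exact: finite_finset.
exact: (measurable_funPTI (U (val e).1 (val e).2) (mhalf (x e))).
Qed.

Lemma prob_sample_bits (x : {ffun edge n -> bool}) :
  P (sample_bits @^-1` [set x]) = (\prod_(e : edge n) (if x e then p else 1 - p))%:E.
Proof.
have [HU1 _] := HU.
rewrite sample_bits_preimage (HU1 [set: edge n]%SET (fun e => half (x e))); last first.
  by move=> e _; exact: mhalf.
rewrite -prodEFin; apply: eq_big => [e|e _]; first by rewrite finset.in_setT.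
exact: prob_half.
Qed.

(** Both sides are linear in [F], so it suffices to compare atoms; the indicator of an atom of the
    cube is a product over edges, which [Es_prod] averages. *)
Lemma expectation_sample (F : {ffun edge n -> bool} -> R) :
  'E_P[fun w => F (sample_bits w)]%E = (Es p (enum (edge n)) F [ffun=> false])%:E.
Proof.
have -> : (fun w => F (sample_bits w)) =
    (fun w => \sum_(x <- index_enum _) F x * \1_(sample_bits @^-1` [set x]) w).
  apply/funext => w; rewrite (bigD1 (sample_bits w)) //= indicE mem_set // mulr1.
  rewrite big1 ?addr0 // => x xw; rewrite indicE memNset ?mulr0 //= => E.
  by rewrite E eqxx in xw.
have [_ ->] := expectation_sum_indic P (index_enum _) F measurable_sample_bits.
congr EFin.
rewrite (@eq_Es _ _ _ _ _ (fun y => \sum_x F x * \prod_(e <- enum (edge n)) (y e == x e)%:R)); last first.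
  move=> y; rewrite (bigD1 y) //= [X in _ * X]big1 ?mulr1; last by move=> e _; rewrite eqxx.
  rewrite big1 ?addr0 // => x xy.
  have [e ee] : exists e, y e != x e.
    apply/existsP; rewrite -negb_forall; apply: contra xy => /forallP H.
    by apply/eqP/ffunP => e; rewrite (eqP (H e)).
  by rewrite big_enum (bigD1 e) //= (negbTE ee) mul0r mulr0.
rewrite Es_sum; apply: eq_bigr => x _; rewrite EsZ; congr (_ * _).
rewrite (Es_prod p (fun e b => (b == x e)%:R)) ?enum_uniq // prob_sample_bits /= big_enum.
by apply: eq_bigr => e _; case: (x e); rewrite /= ?mulr1 ?mulr0 ?addr0 ?add0r.
Qed.

End Transfer.

(** * The hypotheses on [k] and [p] in usable form *)

Lemma ln_le_subr1 (R : realType) (x : R) : 0 < x -> ln x <= x - 1.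
Proof.
by move=> x0; have := expR_ge1Dx (ln x); rewrite lnK ?posrE //; lra.
Qed.

Lemma range_const_bounds (R : realType) : 0 < range_const R <= 1.
Proof.
have [t t1 tE] : exists2 t : R, 1 <= t & range_const R = (t * t * 10)^-1.
  by exists 1000; [lra | ].
have tt : 1 <= t * t * 10 by nra.
by rewrite tE invr_gt0 invf_le1 //; lra.
Qed.

Lemma moment_range_cond (R : realType) (n : nat) (p k : R) : 0 < p <= 1 ->
  moment_range (range_const R) n p k -> moment_cond n p k.
Proof.
move=> p01 /andP[k2]; rewrite /moment_cond.
set a := ln (8 * _); set e := _ + ln _; set b := _ * p * _.
have -> : range_const R * (ln (n%:R * p) / ln n%:R) ^+ 2 * (p * (n%:R - 1)) = b.
  by rewrite /b; ring.
have e0 : 0 <= e by rewrite addr_ge0 ?ln_const_ge0 ?lnVp_ge0.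
(* With a zero denominator the quotient is 0 by convention, contradicting [2 < k]. *)
have [->|e1] := eqVneq e 0; first by rewrite invr0 mulr0; lra.
by rewrite ler_pdivlMr ?lt_def ?e1 // => h; lra.
Qed.

(** The left side of [moment_cond] is at most [107 + 3 L], which is below [250 L] as [L >= 1/2]. On
    the right, [ln (n p) >= 1] and [n - 1 >= n / 2] leave half of [500 L^3 / L^2]. *)
Lemma moment_cond2 (R : realType) (n : nat) (p : R) : (2 <= n)%N -> 0 < p <= 1 ->
  500 / range_const R * ln n%:R ^+ 3 / n%:R <= p -> moment_cond n p 2.
Proof.
move=> n2 p01 kp; have /andP[p0 p1] := p01.
have /andP[c0 c1] := range_const_bounds R.
rewrite /moment_cond; set c := range_const R in kp c0 c1 *.
have N2 : 2 <= n%:R :> R by rewrite ler_nat.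
set N : R := n%:R in kp N2 *.
have L0 : 1/2 <= ln N by exact: ln_ge_half.
set L := ln N in kp L0 *.
have Lp : 0 < L by lra.
have Np : 0 < N by lra.
have xL : 500 * L ^+ 3 <= c * (N * p).
  move: kp; rewrite ler_pdivrMr // => kp.
  have := ler_wpM2l (ltW c0) kp.
  have -> : c * (500 / c * L ^+ 3) = 500 * L ^+ 3 by field; rewrite gt_eqF.
  by rewrite [p * N]mulrC.
have x0 : 0 < N * p by rewrite mulr_gt0.
have xL' : 500 * L ^+ 3 <= N * p by apply: le_trans xL _; rewrite ler_piMl // ltW.
have L3 : 1/8 <= L ^+ 3.
  have -> : (1/8 : R) = (1/2) ^+ 3 by field.
  by apply: lerXn2r; rewrite ?nnegrE; lra.
have X1 : 1 <= ln (N * p).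
  rewrite -ler_expR lnK ?posrE //.
  have h := @expR_le_quad R (1/2) (lexx _).
  have -> : (1 : R) = 1/2 + 1/2 by field.
  rewrite expRD; have := expR_ge0 (1/2 : R); nra.
have r1 : 1 <= (ln (N * p)) ^+ 2 by rewrite expr_ge1 //; lra.
have main : 250 * L <= c * (ln (N * p) / L) ^+ 2 * (p * (N - 1)).
  have L2 : 0 < L ^+ 2 by rewrite exprn_gt0.
  rewrite -(ler_pM2r L2).
  have -> : c * (ln (N * p) / L) ^+ 2 * (p * (N - 1)) * L ^+ 2 =
    ln (N * p) ^+ 2 * (c * (p * (N - 1))) by field; rewrite gt_eqF.
  have -> : 250 * L * L ^+ 2 = 500 * L ^+ 3 / 2 by field.
  have cD : 0 <= c * (p * (N - 1)) by rewrite !mulr_ge0 ?ltW //; lra.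
  have : 1 * (c * (p * (N - 1))) <= ln (N * p) ^+ 2 * (c * (p * (N - 1))) by apply: ler_wpM2r.
  apply: le_trans; have : 0 <= c * p * (N - 2) by rewrite mulr_ge0 ?subr_ge0 // mulr_ge0 // ltW.
  lra.
have l8 : ln (8 * (N - 1)) <= 7 + L.
  apply: (@le_trans _ _ (ln (8 * N))); first by rewrite ler_ln ?posrE; lra.
  by rewrite lnM ?posrE //; have := @ln_le_subr1 R 8 (ltr0n _ 8); rewrite -/L; lra.
have lp : ln p^-1 <= L.
  rewrite /L ler_ln ?posrE ?invr_gt0 // -[leLHS]mul1r ler_pdivrMr //; lra.
have l11 : ln (11 ^+ 5 / 4) <= 50 :> R.
  apply: (@le_trans _ _ (ln (11 ^+ 5))).
    rewrite ler_ln ?posrE ?divr_gt0 ?exprn_gt0 // ler_pdivrMr // ler_peMr ?exprn_ge0 //.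
    by lra.
  by rewrite lnXn // -[leLHS]mulr_natl; have := @ln_le_subr1 R 11 (ltr0n _ 11); lra.
lra.
Qed.

(** * Moments and variance of the adjacency norm *)

Section Transferred.
Variables (d : measure_display) (T : measurableType d) (R : realType) (P : probability T R).
Variables (n : nat) (U : 'I_n -> 'I_n -> {RV P >-> R}) (p : R).
Hypothesis HU : iid_uniform U.
Hypothesis p01 : 0 <= p <= 1.
Let Z (x : {ffun edge n -> bool}) : R := spectral_norm (graph_mx R x).
Let m := Es p (enum (edge n)) Z [ffun=> false].

Lemma adjacency_normE : adjacency_norm U p = fun w => Z (sample_bits U p w).
Proof. by apply/funext => w; rewrite /adjacency_norm adjacencyE. Qed.

Lemma mean_adjacency_norm : fine 'E_P[adjacency_norm U p] = m.
Proof. by rewrite adjacency_normE (expectation_sample HU p01 Z). Qed.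

Lemma upper_momentE (k : R) : upper_moment P (adjacency_norm U p) k =
  (Es p (enum (edge n)) (fun x => Num.max (Z x - m) 0 `^ k) [ffun=> false])%:E.
Proof.
rewrite /upper_moment mean_adjacency_norm adjacency_normE.
exact: (expectation_sample HU p01 (fun x => Num.max (Z x - m) 0 `^ k)).
Qed.

Lemma lower_momentE (k : R) : lower_moment P (adjacency_norm U p) k =
  (Es p (enum (edge n)) (fun x => Num.max (- (Z x - m)) 0 `^ k) [ffun=> false])%:E.
Proof.
rewrite /lower_moment mean_adjacency_norm adjacency_normE.
exact: (expectation_sample HU p01 (fun x => Num.max (- (Z x - m)) 0 `^ k)).
Qed.

Lemma variance_adjacency_norm : 'V_P[adjacency_norm U p]%E =
  (upper_moment P (adjacency_norm U p) 2 + lower_moment P (adjacency_norm U p) 2)%E.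
Proof.
rewrite upper_momentE lower_momentE -EFinD -EsD.
rewrite /variance covariance.unlock mean_adjacency_norm adjacency_normE.
rewrite -(expectation_sample HU p01); congr expectation; apply/funext => w.
rewrite /= /GRing.mul /= !powR_mulrn ?le_max ?lexx ?orbT //.
set t := Z _ - m; case: (leP t 0) => t0.
  by rewrite max_l ?oppr_ge0 // expr0n /= add0r sqrrN.
by rewrite max_r ?oppr_le0 1?ltW // expr0n /= addr0.
Qed.

End Transferred.

Lemma root_moment_le (R : realType) (M k b c : R) : 0 < k -> 0 <= M -> 0 <= b -> b <= c ->
  M <= b `^ (k / 2) -> (M%:E `^ k^-1 <= (c `^ 2^-1)%:E)%E.
Proof.
move=> k0 M0 b0 bc Mb; rewrite poweR_EFin lee_fin.
apply: (@le_trans _ _ ((b `^ (k / 2)) `^ k^-1)).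
  by apply: ge0_ler_powR; rewrite ?nnegrE ?powR_ge0 // invr_ge0 ltW.
rewrite -powRrM [k / 2]mulrC mulfK ?gt_eqF //.
by apply: ge0_ler_powR; rewrite ?nnegrE ?invr_ge0 // (le_trans b0).
Qed.

Lemma var_const_gt0 (R : realType) : 0 < var_const R.
Proof. by have [K <- K1] := var_constE R; lra. Qed.

Theorem theorem2 (R : realType) :
  exists c C C' : R, [/\ 0 < c, 0 < C & 0 < C'] /\
    (forall (n : nat) (p : R), (2 <= n)%N -> 0 < p <= 1 ->
     forall (d : measure_display) (T : measurableType d) (P : probability T R)
       (U : 'I_n -> 'I_n -> {RV P >-> R}), iid_uniform U ->
     forall k : R, moment_range c n p k ->
       ((upper_moment P (adjacency_norm U p) k) `^ (k^-1)
          <= ((C * k * p) `^ (2^-1))%:E)%E /\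
       ((lower_moment P (adjacency_norm U p) k) `^ (k^-1)
          <= ((C' * k * p) `^ (2^-1))%:E)%E) /\
    (exists kappa : R, 0 < kappa /\
     forall (n : nat) (p : R), (1 <= n)%N -> 0 <= p <= 1 ->
       kappa * ln n%:R ^+ 3 / n%:R <= p ->
     forall (d : measure_display) (T : measurableType d) (P : probability T R)
       (U : 'I_n -> 'I_n -> {RV P >-> R}), iid_uniform U ->
       ('V_P[adjacency_norm U p] <= (C * p)%:E)%E).
Proof.
have K0 := var_const_gt0 R; have /andP[c0 c1] := range_const_bounds R.
(* The moments need only 16; the variance adds two moments with [k = 2], whence
   [64 = 2 * 16 * 2]. *)
pose C : R := 64 * var_const R; have C0 : 0 < C by rewrite mulr_gt0.
exists (range_const R), C, C; split => //; split.
  move=> n p n2 p01 d T P U HU k kr.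
  have ple : 0 <= p <= 1 by case/andP: p01 => p0 ->; rewrite ltW.
  have p0 : 0 <= p by case/andP: ple.
  have k2 : 2 < k by case/andP: kr.
  have k1 : 1 <= k by lra.
  have k0 : 0 < k by lra.
  have [up lo] := graph_moments n2 p01 k1 (moment_range_cond p01 kr).
  have b0 : 0 <= 16 * var_const R * k * p by rewrite !mulr_ge0 // ltW.
  have bC : 16 * var_const R * k * p <= C * k * p.
    by have := mulr_ge0 (ltW K0) (mulr_ge0 (ltW k0) p0); rewrite /C; lra.
  rewrite (upper_momentE HU ple) (lower_momentE HU ple).
  by split; apply: (root_moment_le k0 _ b0 bC) => //; apply: Es_ge0 => // x; exact: powR_ge0.
have kap0 : 0 < 500 / range_const R by exact: (divr_gt0 (ltr0n _ 500) c0).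
exists (500 / range_const R); split; first exact: kap0.
move=> n p n1 ple kp d T P U HU; have /andP[p0 p1] := ple.
rewrite (variance_adjacency_norm HU ple) (upper_momentE HU ple) (lower_momentE HU ple).
rewrite -EFinD lee_fin.
case: (ltnP 1 n) => [n2|n1'].
  have N2 : 2 <= n%:R :> R by rewrite ler_nat.
  have Lp : 0 < ln n%:R :> R by have := ln_ge_half N2; lra.
  have N0 : 0 < n%:R :> R by lra.
  have pp : 0 < p := lt_le_trans (divr_gt0 (mulr_gt0 kap0 (exprn_gt0 3 Lp)) N0) kp.
  have p01 : 0 < p <= 1 by rewrite pp.
  have [] := graph_moments n2 p01 (ler1n _ 2) (moment_cond2 n2 p01 kp).
  rewrite divff // powRr1; last by rewrite !mulr_ge0 // ltW.
  by rewrite /C; lra.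
(* For [n = 1] the threshold is 0 and [p = 0] is allowed. There are no edges, so the norm is
   deterministic and both moments vanish. *)
have e0 (e : edge n) : False.
  have := valP e; rewrite ltnNge; apply/negP/negPn.
  by have := ltn_ord (val e).2; case: (n) n1' e => [|[|]] //= _ e; rewrite ltnS leqn0 => /eqP ->.
have -> : enum (edge n) = [::] by case: (enum _) => // e; case: (e0 e).
by rewrite /= !subrr oppr0 maxxx powR0 // addr0 mulr_ge0 // ltW.
Qed.
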